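(* Let $\mathbf{L}$ be one of the logics described in the context. The contraction rules $LC$: from $\Gamma',\Gamma',\Gamma\Rightarrow\Delta$ infer $\Gamma',\Gamma\Rightarrow\Delta$, and $RC$: from $\Gamma\Rightarrow\Delta,\Delta',\Delta'$ infer $\Gamma\Rightarrow\Delta,\Delta'$ are height-preserving admissible in $\mathbf{G3Q\lambda.L}$: if the premiss is derivable with height at most $n$, so is the conclusion.
   Context: Language $\mathcal{L}^\lambda$: fix a signature of $n$-ary predicate letters and an infinite set of variables $x,y,z,\dots$. Terms and formulas are defined simultaneously: terms $t::=x\mid \iota xA$ (definite descriptions), formulas $A::=Px_1\dots x_n\mid x_1=x_2\mid\bot\mid A\wedge A\mid A\vee A\mid A\supset A\mid\forall xA\mid\exists xA\mid\Box A\mid\Diamond A\mid \lambda xA.t$. $\iota x$ binds $x$ in $A$; in $\lambda xA.t$ the occurrences of $x$ in $A$ are bound by $\lambda x$ (the displayed $t$ is not in its scope). $A[y/x]$ replaces free occurrences of $x$ by $y$, with $y$ free for $x$. Atomic formulas are $Px_1\dots x_n$ and $x_1=x_2$. Labelled sequents. Labels $w,v,u,\dots$ form a separate set. Expressions: labelled formulas $w:A$, domain atoms $x\in w$, relational atoms $w\mathscr{R}v$, denotation formulas $D(t,x,w)$ ($t$ a term, $x$ a variable). A sequent $\Gamma\Rightarrow\Delta$ has $\Gamma$ a multiset of labelled formulas, denotation formulas, domain atoms and relational atoms, and $\Delta$ a multiset of labelled formulas and denotation formulas. Substitutions $[y/x]$, $[w/v]$ extend componentwise. ''Fresh'' means not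 occurring in the conclusion of the rule. Calculus $\mathbf{G3Q\lambda.K}$. Initial sequents: $w:p,\Gamma\Rightarrow\Delta,w:p$ ($p$ atomic); $D(y,x,w),\Gamma\Rightarrow\Delta,D(y,x,w)$ ($y$ a variable); $w:\bot,\Gamma\Rightarrow\Delta$. Propositional rules (at one label $w$): $L\wedge$: from $w:A,w:B,\Gamma\Rightarrow\Delta$ infer $w:A\wedge B,\Gamma\Rightarrow\Delta$; $R\wedge$: from $\Gamma\Rightarrow\Delta,w:A$ and $\Gamma\Rightarrow\Delta,w:B$ infer $\Gamma\Rightarrow\Delta,w:A\wedge B$; $L\vee$: from $w:A,\Gamma\Rightarrow\Delta$ and $w:B,\Gamma\Rightarrow\Delta$ infer $w:A\vee B,\Gamma\Rightarrow\Delta$; $R\vee$: from $\Gamma\Rightarrow\Delta,w:A,w:B$ infer $\Gamma\Rightarrow\Delta,w:A\vee B$; $L\supset$: from $\Gamma\Rightarrow\Delta,w:A$ and $w:B,\Gamma\Rightarrow\Delta$ infer $w:A\supset B,\Gamma\Rightarrow\Delta$; $R\supset$: from $w:A,\Gamma\Rightarrow\Delta,w:B$ infer $\Gamma\Rightarrow\Delta,w:A\supset B$. Quantifiers: $L\forall$: from $w:A[y/x],y\in w,w:\forall xA,\Gamma\Rightarrow\Delta$ infer $y\in w,w:\forall xA,\Gamma\Rightarrow\Delta$; $R\forall$ ($z$ fresh): from $z\in w,\Gamma\Rightarrow\Delta,w:A[z/x]$ infer $\Gamma\Rightarrow\Delta,w:\forall xA$; $L\exists$ ($z$ fresh): from $z\in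 w,w:A[z/x],\Gamma\Rightarrow\Delta$ infer $w:\exists xA,\Gamma\Rightarrow\Delta$; $R\exists$: from $y\in w,\Gamma\Rightarrow\Delta,w:\exists xA,w:A[y/x]$ infer $y\in w,\Gamma\Rightarrow\Delta,w:\exists xA$. Modalities: $L\Box$: from $v:A,w\mathscr{R}v,w:\Box A,\Gamma\Rightarrow\Delta$ infer $w\mathscr{R}v,w:\Box A,\Gamma\Rightarrow\Delta$; $R\Box$ ($u$ fresh): from $w\mathscr{R}u,\Gamma\Rightarrow\Delta,u:A$ infer $\Gamma\Rightarrow\Delta,w:\Box A$; $L\Diamond$ ($u$ fresh): from $w\mathscr{R}u,u:A,\Gamma\Rightarrow\Delta$ infer $w:\Diamond A,\Gamma\Rightarrow\Delta$; $R\Diamond$: from $w\mathscr{R}v,\Gamma\Rightarrow\Delta,w:\Diamond A,v:A$ infer $w\mathscr{R}v,\Gamma\Rightarrow\Delta,w:\Diamond A$. Identity: $Ref_=$: from $w:x=x,\Gamma\Rightarrow\Delta$ infer $\Gamma\Rightarrow\Delta$; $RigVar$: from $v:y=z,w:y=z,\Gamma\Rightarrow\Delta$ infer $w:y=z,\Gamma\Rightarrow\Delta$; $Repl$: from $E[z/x],E[y/x],w:y=z,\Gamma\Rightarrow\Delta$ infer $E[y/x],w:y=z,\Gamma\Rightarrow\Delta$, where $E$ is a denotation formula with variable first argument and label $w$, a domain atom $x'\in w$, or a labelled atomic formula $w:p$. $\lambda$: $L\lambda$ ($z$ fresh): from $D(t,z,w),w:B[z/x],\Gamma\Rightarrow\Delta$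 infer $w:\lambda xB.t,\Gamma\Rightarrow\Delta$; $R\lambda$: from $\Gamma\Rightarrow\Delta,w:\lambda xB.t,D(t,y,w)$ and $\Gamma\Rightarrow\Delta,w:\lambda xB.t,w:B[y/x]$ infer $\Gamma\Rightarrow\Delta,w:\lambda xB.t$. Denotation: $LD_1$: from $w:A[x_2/x_1],D(\iota x_1A,x_2,w),\Gamma\Rightarrow\Delta$ infer $D(\iota x_1A,x_2,w),\Gamma\Rightarrow\Delta$; $LD_2$: from $D(\iota x_1A,x_2,w),\Gamma\Rightarrow\Delta,w:A[y/x_1]$ and $w:x_2=y,D(\iota x_1A,x_2,w),\Gamma\Rightarrow\Delta$ infer $D(\iota x_1A,x_2,w),\Gamma\Rightarrow\Delta$; $RD$ ($z$ fresh): from $\Gamma\Rightarrow\Delta,w:A[x_2/x_1]$ and $w:A[z/x_1],\Gamma\Rightarrow\Delta,w:x_2=z$ infer $\Gamma\Rightarrow\Delta,D(\iota x_1A,x_2,w)$; $DenVar$: from $D(x,x,w),\Gamma\Rightarrow\Delta$ infer $\Gamma\Rightarrow\Delta$; $DenId$: from $w:y=x,D(y,x,w),\Gamma\Rightarrow\Delta$ infer $D(y,x,w),\Gamma\Rightarrow\Delta$ ($x,y$ variables). Non-logical rules: $Ref_\mathcal{W}$: from $w\mathscr{R}w,\Gamma\Rightarrow\Delta$ infer $\Gamma\Rightarrow\Delta$; $Ser$ ($u$ fresh): from $w\mathscr{R}u,\Gamma\Rightarrow\Delta$ infer $\Gamma\Rightarrow\Delta$; $Trans$: from $w\mathscr{R}u,w\mathscr{R}v,v\mathscr{R}u,\Gamma\Rightarrow\Delta$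 infer $w\mathscr{R}v,v\mathscr{R}u,\Gamma\Rightarrow\Delta$; $Eucl$: from $v\mathscr{R}u,w\mathscr{R}v,w\mathscr{R}u,\Gamma\Rightarrow\Delta$ infer $w\mathscr{R}v,w\mathscr{R}u,\Gamma\Rightarrow\Delta$, always together with $Eucl^c$: from $v\mathscr{R}v,w\mathscr{R}v,\Gamma\Rightarrow\Delta$ infer $w\mathscr{R}v,\Gamma\Rightarrow\Delta$; $Incr$: from $x\in v,x\in w,w\mathscr{R}v,\Gamma\Rightarrow\Delta$ infer $x\in w,w\mathscr{R}v,\Gamma\Rightarrow\Delta$; $Decr$: from $x\in w,x\in v,w\mathscr{R}v,\Gamma\Rightarrow\Delta$ infer $x\in v,w\mathscr{R}v,\Gamma\Rightarrow\Delta$; $Cons$: from $x\in w,\Gamma\Rightarrow\Delta$ infer $\Gamma\Rightarrow\Delta$. For any set $N$ of these non-logical rules, $\mathbf{G3Q\lambda.L}=\mathbf{G3Q\lambda.K}+N$. Derivations: trees of (pure: no variable both free and bound) sequents with initial sequents at the leaves, built by the rules; the height of a derivation is the number of nodes of its longest branch. $\Gamma\Rightarrow\Delta$ is derivable with height $n$ if it or an alphabetic variant has a derivation of height at most $n$. *)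

(* Defs.v *)
From Stdlib Require Import List Permutation.
From mathcomp Require Import all_boot.

Set Implicit Arguments.
Unset Strict Implicit.
Unset Printing Implicit Defensive.

Definition infinite (T : eqType) : Prop := forall s : seq T, exists x, x \notin s.

Record signature := Signature { pred_letter :> Type; arity : pred_letter -> nat }.

Inductive nonlogical_rule := RefW | Ser | Trans | Eucl | Incr | Decr | Cons.

Section Syntax.
Variables (sg : signature) (V L : eqType).

Inductive term :=
| TVar (x : V)
| TIota (x : V) (A : form)
with form :=
| FPred (P : sg) (xs : (arity P).-tuple V)
| FEq (x y : V)
| FBot
| FAnd (A B : form)
| FOr (A B : form)
| FImp (A B : form)
| FAll (x : V) (A : form)
| FEx (x : V) (A : form)
| FBox (A : form)
| FDia (A : form)
| FLam (x : V) (A : form) (t : term). (* lambda x A . t, with t outside the scope *)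

Definition atomic (A : form) : bool :=
  match A with FPred _ _ | FEq _ _ => true | _ => false end.

Fixpoint fv_form (A : form) : seq V :=
  match A with
  | FPred _ xs => xs
  | FEq x y => [:: x; y]
  | FBot => [::]
  | FAnd A B | FOr A B | FImp A B => fv_form A ++ fv_form B
  | FAll x A | FEx x A => [seq z <- fv_form A | z != x]
  | FBox A | FDia A => fv_form A
  | FLam x A t => [seq z <- fv_form A | z != x] ++ fv_term t
  end
with fv_term (t : term) : seq V :=
  match t with
  | TVar x => [:: x]
  | TIota x A => [seq z <- fv_form A | z != x]
  end.

(* A variable counts as bound as soon as it is attached to a binder, even a
   vacuous one. *)
Fixpoint bv_form (A : form) : seq V :=
  match A with
  | FPred _ _ | FEq _ _ | FBot => [::]
  | FAnd A B | FOr A B | FImp A B => bv_form A ++ bv_form B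
  | FAll x A | FEx x A => x :: bv_form A
  | FBox A | FDia A => bv_form A
  | FLam x A t => x :: bv_form A ++ bv_term t
  end
with bv_term (t : term) : seq V :=
  match t with
  | TVar _ => [::]
  | TIota x A => x :: bv_form A
  end.

(* [subst_form y x A] is A[y/x].  Bound variables are never renamed: the rules
   below only use it when y is free for x in A. *)
Definition subst_var (y x z : V) : V := if z == x then y else z.

Fixpoint subst_form (y x : V) (A : form) : form :=
  match A with
  | FPred P xs => FPred (map_tuple (subst_var y x) xs)
  | FEq a b => FEq (subst_var y x a) (subst_var y x b)
  | FBot => FBot
  | FAnd A B => FAnd (subst_form y x A) (subst_form y x B)
  | FOr A B => FOr (subst_form y x A) (subst_form y x B)
  | FImp A B => FImp (subst_form y x A) (subst_form y x B)
  | FAll z A => FAll z (if z == x then A else subst_form y x A)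
  | FEx z A => FEx z (if z == x then A else subst_form y x A)
  | FBox A => FBox (subst_form y x A)
  | FDia A => FDia (subst_form y x A)
  | FLam z A t =>
      FLam z (if z == x then A else subst_form y x A) (subst_term y x t)
  end
with subst_term (y x : V) (t : term) : term :=
  match t with
  | TVar z => TVar (subst_var y x z)
  | TIota z A => TIota z (if z == x then A else subst_form y x A)
  end.

(* y is free for x: no free occurrence of x lies in the scope of a binder of y *)
Fixpoint free_for (y x : V) (A : form) : bool :=
  match A with
  | FPred _ _ | FEq _ _ | FBot => true
  | FAnd A B | FOr A B | FImp A B => free_for y x A && free_for y x B
  | FAll z A | FEx z A =>
      (z == x) || [&& free_for y x A & (x \notin fv_form A) || (z != y)]
  | FBox A | FDia A => free_for y x A
  | FLam z A t =>
      ((z == x) || [&& free_for y x A & (x \notin fv_form A) || (z != y)])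
      && free_for_term y x t
  end
with free_for_term (y x : V) (t : term) : bool :=
  match t with
  | TVar _ => true
  | TIota z A =>
      (z == x) || [&& free_for y x A & (x \notin fv_form A) || (z != y)]
  end.

(* Alphabetic variants.  The environment lists the pairs of corresponding
   binders crossed so far, innermost first; [same_var e x y] says that x and y
   are bound by corresponding binders, or are the same free variable. *)
Fixpoint same_var (e : seq (V * V)) (x y : V) : bool :=
  match e with
  | [::] => x == y
  | (a, b) :: e' =>
      if (x == a) || (y == b) then (x == a) && (y == b) else same_var e' x y
  end.

Inductive alpha_form : seq (V * V) -> form -> form -> Prop :=
| AlPred e (P : sg) (xs ys : (arity P).-tuple V) :
    (forall i, same_var e (tnth xs i) (tnth ys i)) ->
    alpha_form e (FPred xs) (FPred ys)
| AlEq e x1 x2 y1 y2 :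
    same_var e x1 y1 -> same_var e x2 y2 ->
    alpha_form e (FEq x1 x2) (FEq y1 y2)
| AlBot e : alpha_form e FBot FBot
| AlAnd e A B A' B' :
    alpha_form e A A' -> alpha_form e B B' ->
    alpha_form e (FAnd A B) (FAnd A' B')
| AlOr e A B A' B' :
    alpha_form e A A' -> alpha_form e B B' ->
    alpha_form e (FOr A B) (FOr A' B')
| AlImp e A B A' B' :
    alpha_form e A A' -> alpha_form e B B' ->
    alpha_form e (FImp A B) (FImp A' B')
| AlAll e x x' A A' :
    alpha_form ((x, x') :: e) A A' -> alpha_form e (FAll x A) (FAll x' A')
| AlEx e x x' A A' :
    alpha_form ((x, x') :: e) A A' -> alpha_form e (FEx x A) (FEx x' A')
| AlBox e A A' : alpha_form e A A' -> alpha_form e (FBox A) (FBox A')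
| AlDia e A A' : alpha_form e A A' -> alpha_form e (FDia A) (FDia A')
| AlLam e x x' A A' t t' :
    alpha_form ((x, x') :: e) A A' -> alpha_term e t t' ->
    alpha_form e (FLam x A t) (FLam x' A' t')
with alpha_term : seq (V * V) -> term -> term -> Prop :=
| AlVar e x x' : same_var e x x' -> alpha_term e (TVar x) (TVar x')
| AlIota e x x' A A' :
    alpha_form ((x, x') :: e) A A' -> alpha_term e (TIota x A) (TIota x' A').

(* [rexpr]: what may occur on the right of a sequent; [lexpr]: on the left. *)
Inductive rexpr :=
| Lab (w : L) (A : form)
| Den (t : term) (x : V) (w : L).

Inductive lexpr :=
| Both (e : rexpr)
| Dom (x : V) (w : L)
| Rel (w v : L).

Coercion Both : rexpr >-> lexpr.

Definition sequent : Type := (seq lexpr * seq rexpr)%type.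

(* Lists represent multisets: sequents are identified up to this relation. *)
Definition same_sequent (S S' : sequent) : Prop :=
  Permutation S.1 S'.1 /\ Permutation S.2 S'.2.

Definition fv_rexpr (e : rexpr) : seq V :=
  match e with Lab _ A => fv_form A | Den t x _ => rcons (fv_term t) x end.
Definition fv_lexpr (e : lexpr) : seq V :=
  match e with Both e => fv_rexpr e | Dom x _ => [:: x] | Rel _ _ => [::] end.
Definition bv_rexpr (e : rexpr) : seq V :=
  match e with Lab _ A => bv_form A | Den t _ _ => bv_term t end.
Definition bv_lexpr (e : lexpr) : seq V :=
  match e with Both e => bv_rexpr e | _ => [::] end.
Definition labels_rexpr (e : rexpr) : seq L :=
  match e with Lab w _ => [:: w] | Den _ _ w => [:: w] end.
Definition labels_lexpr (e : lexpr) : seq L :=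
  match e with
  | Both e => labels_rexpr e
  | Dom _ w => [:: w]
  | Rel w v => [:: w; v]
  end.

Definition fv_sequent (S : sequent) : seq V :=
  flatten (map fv_lexpr S.1) ++ flatten (map fv_rexpr S.2).
Definition bv_sequent (S : sequent) : seq V :=
  flatten (map bv_lexpr S.1) ++ flatten (map bv_rexpr S.2).
Definition labels_sequent (S : sequent) : seq L :=
  flatten (map labels_lexpr S.1) ++ flatten (map labels_rexpr S.2).

Definition pure (S : sequent) : Prop :=
  forall x, x \in fv_sequent S -> x \notin bv_sequent S.

Definition fresh_var (z : V) (S : sequent) : Prop :=
  z \notin fv_sequent S ++ bv_sequent S.
Definition fresh_label (u : L) (S : sequent) : Prop :=
  u \notin labels_sequent S.

Definition subst_rexpr (y x : V) (e : rexpr) : rexpr :=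
  match e with
  | Lab w A => Lab w (subst_form y x A)
  | Den t z w => Den (subst_term y x t) (subst_var y x z) w
  end.
Definition subst_lexpr (y x : V) (e : lexpr) : lexpr :=
  match e with
  | Both e => subst_rexpr y x e
  | Dom z w => Dom (subst_var y x z) w
  | Rel w v => Rel w v
  end.

(* the expressions E to which Repl applies, given an identity at label w *)
Inductive replaceable (w : L) : lexpr -> Prop :=
| ReplDen a b : replaceable w (Den (TVar a) b w)
| ReplDom a : replaceable w (Dom a w)
| ReplAtom p : atomic p -> replaceable w (Lab w p).

Implicit Types (Γ : seq lexpr) (Δ : seq rexpr).

(* lets the coercion [Both] apply to the members of an antecedent *)
Local Arguments cons {T} & _ _ : rename.

Local Notation "Γ ⇒ Δ" := (@pair (seq lexpr) (seq rexpr) Γ Δ) (at level 95).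

Inductive initial : sequent -> Prop :=
| InitAtom w p Γ Δ :
    atomic p -> initial (Lab w p :: Γ ⇒ Lab w p :: Δ)
| InitDen w x y Γ Δ :
    initial (Den (TVar y) x w :: Γ ⇒ Den (TVar y) x w :: Δ)
| InitBot w Γ Δ :
    initial (Lab w FBot :: Γ ⇒ Δ).

(* [rule1 N S1 S] : S follows from S1 by a one-premiss rule of G3Qlambda.K + N.
   A fresh variable is automatically free for x in the formulas of the
   conclusion, so [free_for] is only required of the other instances. *)
Inductive rule1 (N : nonlogical_rule -> Prop) : sequent -> sequent -> Prop :=
| LAnd w A B Γ Δ :
    rule1 N (Lab w A :: Lab w B :: Γ ⇒ Δ)
            (Lab w (FAnd A B) :: Γ ⇒ Δ)
| ROr w A B Γ Δ :
    rule1 N (Γ ⇒ Lab w A :: Lab w B :: Δ) (Γ ⇒ Lab w (FOr A B) :: Δ)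
| RImp w A B Γ Δ :
    rule1 N (Lab w A :: Γ ⇒ Lab w B :: Δ) (Γ ⇒ Lab w (FImp A B) :: Δ)
| LAll w x y A Γ Δ :
    free_for y x A ->
    rule1 N
      (Lab w (subst_form y x A) :: Dom y w :: Lab w (FAll x A) :: Γ ⇒ Δ)
      (Dom y w :: Lab w (FAll x A) :: Γ ⇒ Δ)
| RAll w x z A Γ Δ :
    fresh_var z (Γ ⇒ Lab w (FAll x A) :: Δ) ->
    rule1 N (Dom z w :: Γ ⇒ Lab w (subst_form z x A) :: Δ)
            (Γ ⇒ Lab w (FAll x A) :: Δ)
| LEx w x z A Γ Δ :
    fresh_var z (Lab w (FEx x A) :: Γ ⇒ Δ) ->
    rule1 N (Dom z w :: Lab w (subst_form z x A) :: Γ ⇒ Δ)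
            (Lab w (FEx x A) :: Γ ⇒ Δ)
| REx w x y A Γ Δ :
    free_for y x A ->
    rule1 N (Dom y w :: Γ ⇒ Lab w (FEx x A) :: Lab w (subst_form y x A) :: Δ)
            (Dom y w :: Γ ⇒ Lab w (FEx x A) :: Δ)
| LBox w v A Γ Δ :
    rule1 N (Lab v A :: Rel w v :: Lab w (FBox A) :: Γ ⇒ Δ)
            (Rel w v :: Lab w (FBox A) :: Γ ⇒ Δ)
| RBox w u A Γ Δ :
    fresh_label u (Γ ⇒ Lab w (FBox A) :: Δ) ->
    rule1 N (Rel w u :: Γ ⇒ Lab u A :: Δ) (Γ ⇒ Lab w (FBox A) :: Δ)
| LDia w u A Γ Δ :
    fresh_label u (Lab w (FDia A) :: Γ ⇒ Δ) ->
    rule1 N (Rel w u :: Lab u A :: Γ ⇒ Δ) (Lab w (FDia A) :: Γ ⇒ Δ)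
| RDia w v A Γ Δ :
    rule1 N (Rel w v :: Γ ⇒ Lab w (FDia A) :: Lab v A :: Δ)
            (Rel w v :: Γ ⇒ Lab w (FDia A) :: Δ)
| RefEq w x Γ Δ :
    rule1 N (Lab w (FEq x x) :: Γ ⇒ Δ) (Γ ⇒ Δ)
| RigVar w v y z Γ Δ :
    rule1 N (Lab v (FEq y z) :: Lab w (FEq y z) :: Γ ⇒ Δ)
            (Lab w (FEq y z) :: Γ ⇒ Δ)
| Repl w x y z E Γ Δ :
    replaceable w E ->
    rule1 N
      (subst_lexpr z x E :: subst_lexpr y x E :: Lab w (FEq y z) :: Γ ⇒ Δ)
      (subst_lexpr y x E :: Lab w (FEq y z) :: Γ ⇒ Δ)
| LLam w x z t B Γ Δ :
    fresh_var z (Lab w (FLam x B t) :: Γ ⇒ Δ) ->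
    rule1 N (Den t z w :: Lab w (subst_form z x B) :: Γ ⇒ Δ)
            (Lab w (FLam x B t) :: Γ ⇒ Δ)
| LD1 w x1 x2 A Γ Δ :
    free_for x2 x1 A ->
    rule1 N
      (Lab w (subst_form x2 x1 A) :: Den (TIota x1 A) x2 w :: Γ ⇒ Δ)
      (Den (TIota x1 A) x2 w :: Γ ⇒ Δ)
| DenVar w x Γ Δ :
    rule1 N (Den (TVar x) x w :: Γ ⇒ Δ) (Γ ⇒ Δ)
| DenId w x y Γ Δ :
    rule1 N (Lab w (FEq y x) :: Den (TVar y) x w :: Γ ⇒ Δ)
            (Den (TVar y) x w :: Γ ⇒ Δ)
| RuleRefW w Γ Δ :
    N RefW -> rule1 N (Rel w w :: Γ ⇒ Δ) (Γ ⇒ Δ)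
| RuleSer w u Γ Δ :
    N Ser -> fresh_label u (Γ ⇒ Δ) -> rule1 N (Rel w u :: Γ ⇒ Δ) (Γ ⇒ Δ)
| RuleTrans w v u Γ Δ :
    N Trans ->
    rule1 N (Rel w u :: Rel w v :: Rel v u :: Γ ⇒ Δ) (Rel w v :: Rel v u :: Γ ⇒ Δ)
| RuleEucl w v u Γ Δ :
    N Eucl ->
    rule1 N (Rel v u :: Rel w v :: Rel w u :: Γ ⇒ Δ) (Rel w v :: Rel w u :: Γ ⇒ Δ)
| RuleEuclc w v Γ Δ :
    N Eucl -> rule1 N (Rel v v :: Rel w v :: Γ ⇒ Δ) (Rel w v :: Γ ⇒ Δ)
| RuleIncr w v x Γ Δ :
    N Incr ->
    rule1 N (Dom x v :: Dom x w :: Rel w v :: Γ ⇒ Δ) (Dom x w :: Rel w v :: Γ ⇒ Δ)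
| RuleDecr w v x Γ Δ :
    N Decr ->
    rule1 N (Dom x w :: Dom x v :: Rel w v :: Γ ⇒ Δ) (Dom x v :: Rel w v :: Γ ⇒ Δ)
| RuleCons w x Γ Δ :
    N Cons -> rule1 N (Dom x w :: Γ ⇒ Δ) (Γ ⇒ Δ).

(* [rule2 S1 S2 S] : S follows from S1 and S2 by a two-premiss rule. *)
Inductive rule2 : sequent -> sequent -> sequent -> Prop :=
| RAnd w A B Γ Δ :
    rule2 (Γ ⇒ Lab w A :: Δ) (Γ ⇒ Lab w B :: Δ) (Γ ⇒ Lab w (FAnd A B) :: Δ)
| LOr w A B Γ Δ :
    rule2 (Lab w A :: Γ ⇒ Δ) (Lab w B :: Γ ⇒ Δ)
          (Lab w (FOr A B) :: Γ ⇒ Δ)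
| LImp w A B Γ Δ :
    rule2 (Γ ⇒ Lab w A :: Δ) (Lab w B :: Γ ⇒ Δ)
          (Lab w (FImp A B) :: Γ ⇒ Δ)
| RLam w x y t B Γ Δ :
    free_for y x B ->
    rule2 (Γ ⇒ Lab w (FLam x B t) :: Den t y w :: Δ)
          (Γ ⇒ Lab w (FLam x B t) :: Lab w (subst_form y x B) :: Δ)
          (Γ ⇒ Lab w (FLam x B t) :: Δ)
| LD2 w x1 x2 y A Γ Δ :
    free_for y x1 A ->
    rule2
      (Den (TIota x1 A) x2 w :: Γ ⇒ Lab w (subst_form y x1 A) :: Δ)
      (Lab w (FEq x2 y) :: Den (TIota x1 A) x2 w :: Γ ⇒ Δ)
      (Den (TIota x1 A) x2 w :: Γ ⇒ Δ)
| RD w x1 x2 z A Γ Δ :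
    free_for x2 x1 A ->
    fresh_var z (Γ ⇒ Den (TIota x1 A) x2 w :: Δ) ->
    rule2 (Γ ⇒ Lab w (subst_form x2 x1 A) :: Δ)
          (Lab w (subst_form z x1 A) :: Γ ⇒ Lab w (FEq x2 z) :: Δ)
          (Γ ⇒ Den (TIota x1 A) x2 w :: Δ).

(* [derives N h S] : S is the root of a derivation of height h. *)
Inductive derives (N : nonlogical_rule -> Prop) : nat -> sequent -> Prop :=
| DerInit S0 S :
    initial S0 -> same_sequent S0 S -> pure S -> derives N 1 S
| Der1 h S1 S0 S :
    rule1 N S1 S0 -> same_sequent S0 S -> pure S ->
    derives N h S1 -> derives N h.+1 S
| Der2 h1 h2 S1 S2 S0 S :
    rule2 S1 S2 S0 -> same_sequent S0 S -> pure S ->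
    derives N h1 S1 -> derives N h2 S2 -> derives N (maxn h1 h2).+1 S.

Inductive variant_rexpr : rexpr -> rexpr -> Prop :=
| VarLab w A A' : alpha_form [::] A A' -> variant_rexpr (Lab w A) (Lab w A')
| VarDen t t' x w :
    alpha_term [::] t t' -> variant_rexpr (Den t x w) (Den t' x w).

Inductive variant_lexpr : lexpr -> lexpr -> Prop :=
| VarBoth e e' : variant_rexpr e e' -> variant_lexpr (Both e) (Both e')
| VarDom x w : variant_lexpr (Dom x w) (Dom x w)
| VarRel w v : variant_lexpr (Rel w v) (Rel w v).

(* Reflexive, so a sequent counts among its own alphabetic variants. *)
Definition variant (S S' : sequent) : Prop :=
  exists2 S'', same_sequent S'' S' &
    Forall2 variant_lexpr S.1 S''.1 /\ Forall2 variant_rexpr S.2 S''.2.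

Definition derivable (N : nonlogical_rule -> Prop) (n : nat) (S : sequent) : Prop :=
  exists S' h, [/\ variant S S', h <= n & derives N h S'].

End Syntax.

(* Main.v *)
(** Contraction is immediate in a calculus whose sequents are compared as sets,
whose formulas are taken up to renaming of bound variables, and whose rules all
keep their principal expressions.  Such a calculus [nderiv] is set up on
nameless formulas, a binder over variables in X taking its body over [option X],
with one premiss for every value of an eigenvariable; weakening and invertibility
then hold by a direct induction, without any renaming of eigenvariables.

A named derivation yields a nameless one of the same height, for every renaming
of the free variables and labels of its conclusion.  Conversely, a principal
expression that a named rule consumes can be dropped from the nameless premiss by
invertibility, and a nameless derivation involves finitely many variables: any
named sequent whose bound variables avoid them inherits a named derivation of at
most the same height.  Every sequent has a variant of this kind. *)

From Stdlib Require Import List Permutation.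
Require Import Defs.
From mathcomp Require Import all_boot.

Set Implicit Arguments.
Unset Strict Implicit.
Unset Printing Implicit Defensive.

Scheme form_term_rec := Induction for form Sort Prop
  with term_form_rec := Induction for term Sort Prop.
Combined Scheme form_term_ind from form_term_rec, term_form_rec.
Scheme alpha_form_term_rec := Minimality for alpha_form Sort Prop
  with alpha_term_form_rec := Minimality for alpha_term Sort Prop.
Combined Scheme alpha_form_term_ind from alpha_form_term_rec, alpha_term_form_rec.

Local Arguments FEq {sg V} x y.
Local Arguments FBot {sg V}.
Local Arguments TVar {sg V} x.
Local Arguments Dom {sg V L} x w.
Local Arguments Rel {sg V L} w v.

Section Nameless.
Variable sg : signature.

(** * Nameless formulas *)

(** [None] stands for the variable of the innermost binder and [Some x] for an outer one, so
    alphabetic variants become equal. Predicate arguments form a list of any length; the arity is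
    recovered from the named side. *)
Inductive nform (X : Type) : Type :=
| NPred (P : sg) (xs : seq X)
| NEq (x y : X)
| NBot
| NAnd (A B : nform X)
| NOr (A B : nform X)
| NImp (A B : nform X)
| NAll (A : nform (option X))
| NEx (A : nform (option X))
| NBox (A : nform X)
| NDia (A : nform X)
| NLam (A : nform (option X)) (t : nterm X)
with nterm (X : Type) : Type :=
| NVar (x : X)
| NIota (A : nform (option X)).

Definition natomic X (A : nform X) : bool :=
  match A with NPred _ _ | NEq _ _ => true | _ => false end.

Fixpoint nmap_form X Y (f : X -> Y) (A : nform X) : nform Y :=
  match A with
  | NPred P xs => NPred P (map f xs)
  | NEq x y => NEq (f x) (f y)
  | NBot => NBot Y
  | NAnd A B => NAnd (nmap_form f A) (nmap_form f B)
  | NOr A B => NOr (nmap_form f A) (nmap_form f B)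
  | NImp A B => NImp (nmap_form f A) (nmap_form f B)
  | NAll A => NAll (nmap_form (omap f) A)
  | NEx A => NEx (nmap_form (omap f) A)
  | NBox A => NBox (nmap_form f A)
  | NDia A => NDia (nmap_form f A)
  | NLam A t => NLam (nmap_form (omap f) A) (nmap_term f t)
  end
with nmap_term X Y (f : X -> Y) (t : nterm X) : nterm Y :=
  match t with
  | NVar x => NVar (f x)
  | NIota A => NIota (nmap_form (omap f) A)
  end.

(** [pmap id] discards the variable of the binder being left and strips [Some] from the others. *)
Fixpoint nfv_form X (A : nform X) : seq X :=
  match A with
  | NPred _ xs => xs
  | NEq x y => [:: x; y]
  | NBot => [::]
  | NAnd A B | NOr A B | NImp A B => nfv_form A ++ nfv_form B
  | NAll A | NEx A => pmap id (nfv_form A)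
  | NBox A | NDia A => nfv_form A
  | NLam A t => pmap id (nfv_form A) ++ nfv_term t
  end
with nfv_term X (t : nterm X) : seq X :=
  match t with
  | NVar x => [:: x]
  | NIota A => pmap id (nfv_form A)
  end.

(** * Translation of named formulas *)

Variable V : eqType.

(** The test against x comes before r is consulted, so an inner binder shadows an outer one of the
    same name. *)
Definition bind X (r : V -> X) (x z : V) : option X :=
  if z == x then None else Some (r z).

Fixpoint tr_form X (r : V -> X) (A : form sg V) : nform X :=
  match A with
  | FPred P xs => NPred P (map r xs)
  | FEq x y => NEq (r x) (r y)
  | FBot => NBot X
  | FAnd A B => NAnd (tr_form r A) (tr_form r B)
  | FOr A B => NOr (tr_form r A) (tr_form r B)
  | FImp A B => NImp (tr_form r A) (tr_form r B)
  | FAll x A => NAll (tr_form (bind r x) A)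
  | FEx x A => NEx (tr_form (bind r x) A)
  | FBox A => NBox (tr_form r A)
  | FDia A => NDia (tr_form r A)
  | FLam x A t => NLam (tr_form (bind r x) A) (tr_term r t)
  end
with tr_term X (r : V -> X) (t : term sg V) : nterm X :=
  match t with
  | TVar x => NVar (r x)
  | TIota x A => NIota (tr_form (bind r x) A)
  end.

Lemma bind_ext X (r r' : V -> X) x (s : seq V) :
  {in [seq z <- s | z != x], r =1 r'} -> {in s, bind r x =1 bind r' x}.
Proof.
move=> e z zs; rewrite /bind; case: eqP => // /eqP zx.
by rewrite e // mem_filter zx.
Qed.

(** Stands in for functional extensionality: assignments under binders are mostly equal only
    pointwise, and sometimes only on the free variables. *)
Lemma tr_ext :
  (forall A X (r r' : V -> X), {in fv_form A, r =1 r'} -> tr_form r A = tr_form r' A) /\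
  (forall t X (r r' : V -> X), {in fv_term t, r =1 r'} -> tr_term r t = tr_term r' t).
Proof.
apply: form_term_ind => //=.
- by move=> P xs X r r' e; congr NPred; apply/eq_in_map.
- by move=> x y X r r' e; rewrite !e ?inE ?eqxx ?orbT.
- by move=> A IA B IB X r r' e; rewrite (IA _ r r') ?(IB _ r r') // => z zA;
    apply: e; rewrite mem_cat zA ?orbT.
- by move=> A IA B IB X r r' e; rewrite (IA _ r r') ?(IB _ r r') // => z zA;
    apply: e; rewrite mem_cat zA ?orbT.
- by move=> A IA B IB X r r' e; rewrite (IA _ r r') ?(IB _ r r') // => z zA;
    apply: e; rewrite mem_cat zA ?orbT.
- by move=> x A IA X r r' /bind_ext/IA ->.
- by move=> x A IA X r r' /bind_ext/IA ->.
- by move=> A IA X r r' /IA ->.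
- by move=> A IA X r r' /IA ->.
- move=> x A IA t It X r r' e; rewrite (It _ r r'); last first.
    by move=> z zt; apply: e; rewrite mem_cat zt orbT.
  by rewrite (IA _ (bind r x) (bind r' x)) //; apply: bind_ext => z zA;
  apply: e; rewrite mem_cat zA.
- by move=> x X r r' e; rewrite e ?inE.
- by move=> x A IA X r r' /bind_ext/IA ->.
Qed.

Lemma omap_bind X Y (f : X -> Y) (r : V -> X) x :
  omap f \o bind r x =1 bind (f \o r) x.
Proof. by move=> z; rewrite /bind /=; case: eqP. Qed.

Lemma tr_map :
  (forall A X Y (f : X -> Y) (r : V -> X), nmap_form f (tr_form r A) = tr_form (f \o r) A) /\
  (forall t X Y (f : X -> Y) (r : V -> X), nmap_term f (tr_term r t) = tr_term (f \o r) t).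
Proof.
have eb A X Y (f : X -> Y) (r : V -> X) x :
  tr_form (omap f \o bind r x) A = tr_form (bind (f \o r) x) A.
  by apply: (proj1 tr_ext) => z _; apply: omap_bind.
apply: form_term_ind => /=.
- by move=> P xs X Y f r; rewrite -map_comp.
- by [].
- by [].
- by move=> A IA B IB X Y f r; rewrite IA IB.
- by move=> A IA B IB X Y f r; rewrite IA IB.
- by move=> A IA B IB X Y f r; rewrite IA IB.
- by move=> x A IA X Y f r; rewrite IA eb.
- by move=> x A IA X Y f r; rewrite IA eb.
- by move=> A IA X Y f r; rewrite IA.
- by move=> A IA X Y f r; rewrite IA.
- by move=> x A IA t It X Y f r; rewrite IA It eb.
- by [].
- by move=> x A IA X Y f r; rewrite IA eb.
Qed.

(** Substitution turns into a change of assignment. The two could differ only under a binder that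
    captures y, which [free_for] excludes. *)
Lemma tr_subst y x :
  (forall A X (r : V -> X), free_for y x A ->
     tr_form r (subst_form y x A) = tr_form (r \o subst_var y x) A) /\
  (forall t X (r : V -> X), free_for_term y x t ->
     tr_term r (subst_term y x t) = tr_term (r \o subst_var y x) t).
Proof.
have eb z A X (r : V -> X) :
  (forall Y (r : V -> Y), free_for y x A ->
     tr_form r (subst_form y x A) = tr_form (r \o subst_var y x) A) ->
  (z == x) || free_for y x A && ((x \notin fv_form A) || (z != y)) ->
  tr_form (bind r z) (if z == x then A else subst_form y x A) =
  tr_form (bind (r \o subst_var y x) z) A.
  move=> IA; case: (eqVneq z x) => [-> _|zx /= /andP[fA h]].
    by apply: (proj1 tr_ext) => v _; rewrite /bind /subst_var /=; case: eqP.
  rewrite IA //; apply: (proj1 tr_ext) => v vA; rewrite /bind /subst_var /=.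
  (* As x occurs free in A, the hypothesis [h] forces z to differ from y, so the binder z does not
     catch the substituted y. *)
  case: (eqVneq v x) => [vx|//]; subst v.
  by rewrite vA /= in h; rewrite eq_sym (negPf h) eq_sym (negPf zx).
apply: form_term_ind => /=.
- by move=> P xs X r _; rewrite -map_comp.
- by [].
- by [].
- by move=> A IA B IB X r /andP[/IA-> /IB->].
- by move=> A IA B IB X r /andP[/IA-> /IB->].
- by move=> A IA B IB X r /andP[/IA-> /IB->].
- by move=> z A IA X r h; rewrite eb.
- by move=> z A IA X r h; rewrite eb.
- by move=> A IA X r /IA->.
- by move=> A IA X r /IA->.
- by move=> z A IA t It X r /andP[h /It->]; rewrite eb.
- by [].
- by move=> z A IA X r h; rewrite eb.
Qed.

(** [odflt y] sends [None] to y and strips [Some]. Nameless binders capture nothing, so there is no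
    side condition. *)
Definition inst X (y : X) (B : nform (option X)) : nform X :=
  nmap_form (odflt y) B.

(** Filling the hole left by [bind r x] with r y gives, variable by variable, r after the
    replacement of x by y. *)
Lemma tr_inst X (r : V -> X) y x A : free_for y x A ->
  tr_form r (subst_form y x A) = inst (r y) (tr_form (bind r x) A).
Proof.
move=> fA; rewrite /inst (proj1 (tr_subst _ _)) // (proj1 tr_map).
by apply: (proj1 tr_ext) => z _; rewrite /= /bind /subst_var; case: eqP.
Qed.

Lemma free_for_bv y x :
  (forall A : form sg V, y \notin bv_form A -> free_for y x A) /\
  (forall t : term sg V, y \notin bv_term t -> free_for_term y x t).
Proof.
apply: form_term_ind => //=.
- by move=> A IA B IB; rewrite mem_cat negb_or => /andP[/IA-> /IB->].
- by move=> A IA B IB; rewrite mem_cat negb_or => /andP[/IA-> /IB->].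
- by move=> A IA B IB; rewrite mem_cat negb_or => /andP[/IA-> /IB->].
- by move=> z A IA; rewrite inE negb_or eq_sym => /andP[-> /IA->]; rewrite !orbT.
- by move=> z A IA; rewrite inE negb_or eq_sym => /andP[-> /IA->]; rewrite !orbT.
- by move=> z A IA t It;
  rewrite inE mem_cat !negb_or eq_sym => /and3P[-> /IA-> /It->]; rewrite !orbT.
- by move=> z A IA; rewrite inE negb_or eq_sym => /andP[-> /IA->]; rewrite !orbT.
Qed.

Lemma bv_subst y x :
  (forall A : form sg V, bv_form (subst_form y x A) = bv_form A) /\
  (forall t : term sg V, bv_term (subst_term y x t) = bv_term t).
Proof.
apply: form_term_ind => //=.
- by move=> A -> B ->.
- by move=> A -> B ->.
- by move=> A -> B ->.
- by move=> z A IA; case: eqP => _; rewrite ?IA.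
- by move=> z A IA; case: eqP => _; rewrite ?IA.
- by move=> z A IA t ->; case: eqP => _; rewrite ?IA.
- by move=> z A IA; case: eqP => _; rewrite ?IA.
Qed.

Lemma In_cat T (x : T) s t : In x (s ++ t) <-> In x s \/ In x t.
Proof. exact: in_app_iff. Qed.

Lemma In_pmap X (x : X) s : In (Some x) s -> In x (pmap id s).
Proof.
elim: s => //= a s IH [->|/IH]; first by left.
by case: a => //=; right.
Qed.

Lemma In_map T U (f : T -> U) y s : In y (map f s) <-> exists x, f x = y /\ In x s.
Proof. exact: in_map_iff. Qed.

Lemma In_mem (T : eqType) (x : T) s : In x s <-> x \in s.
Proof.
elim: s => //= a s [h1 h2]; rewrite inE; split.
  by case=> [->|/h1->]; rewrite ?eqxx ?orbT.
by case/orP => [/eqP->|/h2]; [left|right].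
Qed.

(** At the identity assignment this bounds the free variables of every naming of a nameless sequent,
    as purity and freshness will require. *)
Lemma nfv_tr :
  (forall A X (r : V -> X) x, x \in fv_form A -> In (r x) (nfv_form (tr_form r A))) /\
  (forall t X (r : V -> X) x, x \in fv_term t -> In (r x) (nfv_term (tr_term r t))).
Proof.
have eb z A X (r : V -> X) x :
  (forall X (r : V -> X) x, x \in fv_form A -> In (r x) (nfv_form (tr_form r A))) ->
  x \in [seq y <- fv_form A | y != z] -> In (r x) (pmap id (nfv_form (tr_form (bind r z) A))).
  move=> IA; rewrite mem_filter => /andP[xz /IA h]; apply: In_pmap.
  by have := h _ (bind r z); rewrite /bind (negPf xz).
apply: form_term_ind => //=.
- by move=> P xs X r x xx; apply/In_map; exists x; split=> //; apply/In_mem.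
- by move=> a b X r x; rewrite !inE => /orP[]/eqP->; auto.
- by move=> A IA B IB X r x; rewrite mem_cat In_cat => /orP[/IA|/IB]; auto.
- by move=> A IA B IB X r x; rewrite mem_cat In_cat => /orP[/IA|/IB]; auto.
- by move=> A IA B IB X r x; rewrite mem_cat In_cat => /orP[/IA|/IB]; auto.
- by move=> z A IA X r x; apply: eb.
- by move=> z A IA X r x; apply: eb.
- by move=> z A IA t It X r x; rewrite mem_cat In_cat => /orP[/eb|/It]; auto.
- by move=> y X r x; rewrite inE => /eqP->; auto.
- by move=> z A IA X r x; apply: eb.
Qed.

(** With [tr_alpha], at the empty environment and identity assignments, this makes alphabetic
    equivalence the same as equality of translations. The link between environment and assignments
    survives a binder because [same_var] and [bind] both consult the innermost binder first. *)
Lemma alpha_tr :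
  (forall e A A', alpha_form e A A' -> forall X (r r' : V -> X),
     (forall x y, same_var e x y -> r x = r' y) -> tr_form r A = tr_form r' A') /\
  (forall e t t', alpha_term e t t' -> forall X (r r' : V -> X),
     (forall x y, same_var e x y -> r x = r' y) -> tr_term r t = tr_term r' t').
Proof.
have eb e a a' X (r r' : V -> X) : (forall x y, same_var e x y -> r x = r' y) ->
   forall x y, same_var ((a, a') :: e) x y -> bind r a x = bind r' a' y.
  move=> h x y /=; rewrite /bind; case: (x == a); case: (y == a') => //=.
  by move=> /h->.
apply: alpha_form_term_ind => /=.
- move=> e P xs ys h X r r' hr; congr NPred.
  suff /(congr1 val) : map_tuple r xs = map_tuple r' ys by [].
  by apply: eq_from_tnth => i; rewrite !tnth_map; apply: hr.
- by move=> e a b c d ac bd X r r' hr; rewrite (hr _ _ ac) (hr _ _ bd).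
- by [].
- by move=> e A B A' B' _ IA _ IB X r r' hr; rewrite (IA _ _ _ hr) (IB _ _ _ hr).
- by move=> e A B A' B' _ IA _ IB X r r' hr; rewrite (IA _ _ _ hr) (IB _ _ _ hr).
- by move=> e A B A' B' _ IA _ IB X r r' hr; rewrite (IA _ _ _ hr) (IB _ _ _ hr).
- by move=> e x x' A A' _ IA X r r' hr; congr NAll; apply: IA; apply: eb.
- by move=> e x x' A A' _ IA X r r' hr; congr NEx; apply: IA; apply: eb.
- by move=> e A A' _ IA X r r' hr; rewrite (IA _ _ _ hr).
- by move=> e A A' _ IA X r r' hr; rewrite (IA _ _ _ hr).
- move=> e x x' A A' t t' _ IA _ It X r r' hr; rewrite (It _ _ _ hr).
  by congr NLam; apply: IA; apply: eb.
- by move=> e x x' xx X r r' hr; rewrite (hr _ _ xx).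
- by move=> e x x' A A' _ IA X r r' hr; congr NIota; apply: IA; apply: eb.
Qed.

Lemma tr_alpha :
  (forall A A' e X (r r' : V -> X), (forall x y, r x = r' y -> same_var e x y) ->
     tr_form r A = tr_form r' A' -> alpha_form e A A') /\
  (forall t t' e X (r r' : V -> X), (forall x y, r x = r' y -> same_var e x y) ->
     tr_term r t = tr_term r' t' -> alpha_term e t t').
Proof.
have eb e a a' X (r r' : V -> X) : (forall x y, r x = r' y -> same_var e x y) ->
   forall x y, bind r a x = bind r' a' y -> same_var ((a, a') :: e) x y.
  move=> h x y /=; rewrite /bind; case: (x == a); case: (y == a') => //=.
  by case=> /h.
apply: form_term_ind => /=.
- move=> P xs [] //= Q ys e X r r' hr [PQ]; subst Q => h.
  have h' : map_tuple r xs = map_tuple r' ys by apply: val_inj.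
  by apply: AlPred => i; apply: hr; move/(congr1 (fun s => tnth s i)): h'; rewrite !tnth_map.
- by move=> x y [] //= x' y' e X r r' hr [/hr ? /hr ?]; constructor.
- by case=> //= *; constructor.
- by move=> A IA B IB [] //= A' B' e X r r' hr [/IA ? /IB ?]; constructor; auto.
- by move=> A IA B IB [] //= A' B' e X r r' hr [/IA ? /IB ?]; constructor; auto.
- by move=> A IA B IB [] //= A' B' e X r r' hr [/IA ? /IB ?]; constructor; auto.
- by move=> x A IA [] //= x' A' e X r r' hr [/IA h]; constructor; apply/h/eb.
- by move=> x A IA [] //= x' A' e X r r' hr [/IA h]; constructor; apply/h/eb.
- by move=> A IA [] //= A' e X r r' hr [/IA ?]; constructor; auto.
- by move=> A IA [] //= A' e X r r' hr [/IA ?]; constructor; auto.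
- move=> x A IA t It [] //= x' A' t' e X r r' hr [/IA h /It ?].
  by constructor; [apply/h/eb|auto].
- by move=> x [] //= x' e X r r' hr [/hr ?]; constructor.
- by move=> x A IA [] //= x' A' e X r r' hr [/IA h]; constructor; apply/h/eb.
Qed.

Hypothesis infV : infinite V.

(** The assignment r is general because, under a binder, the induction hypothesis is applied with
    the old bound variable sent to its new name. *)
Lemma rename_bound (F : seq V) :
  (forall A (r : V -> V), exists2 A', tr_form id A' = tr_form r A
     & {in bv_form A', forall x, x \notin F}) /\
  (forall t (r : V -> V), exists2 t', tr_term id t' = tr_term r t
     & {in bv_term t', forall x, x \notin F}).
Proof.
have eb x A (r : V -> V) :
  (forall r : V -> V, exists2 A', tr_form id A' = tr_form r A
     & {in bv_form A', forall x, x \notin F}) ->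
  exists x' A', tr_form (bind id x') A' = tr_form (bind r x) A /\
    {in x' :: bv_form A', forall x, x \notin F}.
  (* Besides F, the new name avoids the images of the free variables of A, which it would otherwise
     capture. *)
  move=> IA; have [x'] := infV (F ++ map r (fv_form A)).
  rewrite mem_cat negb_or => /andP[xF xA].
  have [A' eA hA] := IA (fun z => if z == x then x' else r z).
  exists x', A'; split; last by move=> z; rewrite inE => /orP[/eqP->|/hA].
  (* The body is translated with x' still free, and x' is abstracted afterwards. *)
  have -> : tr_form (bind id x') A' = nmap_form (bind id x') (tr_form id A').
    by rewrite (proj1 tr_map).
  rewrite eA (proj1 tr_map); apply: (proj1 tr_ext) => z zA; rewrite /= /bind /=.
  case: (eqVneq z x) => _; rewrite ?eqxx //; case: eqP => // e.
  by rewrite -e map_f in xA.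
apply: form_term_ind => /=.
- by move=> P xs r; exists (FPred (map_tuple r xs)) => //=; rewrite map_id.
- by move=> x y r; exists (FEq (r x) (r y)).
- by exists FBot.
- move=> A IA B IB r; have [A' <- hA] := IA r; have [B' <- hB] := IB r.
  by exists (FAnd A' B') => //= x; rewrite mem_cat => /orP[/hA|/hB].
- move=> A IA B IB r; have [A' <- hA] := IA r; have [B' <- hB] := IB r.
  by exists (FOr A' B') => //= x; rewrite mem_cat => /orP[/hA|/hB].
- move=> A IA B IB r; have [A' <- hA] := IA r; have [B' <- hB] := IB r.
  by exists (FImp A' B') => //= x; rewrite mem_cat => /orP[/hA|/hB].
- move=> x A IA r; have [x' [A' [<- hA]]] := eb x A r IA.
  by exists (FAll x' A').
- move=> x A IA r; have [x' [A' [<- hA]]] := eb x A r IA.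
  by exists (FEx x' A').
- by move=> A IA r; have [A' <- hA] := IA r; exists (FBox A').
- by move=> A IA r; have [A' <- hA] := IA r; exists (FDia A').
- move=> x A IA t It r; have [x' [A' [<- hA]]] := eb x A r IA.
  have [t' <- ht] := It r; exists (FLam x' A' t') => //= z.
  by rewrite -cat_cons mem_cat => /orP[/hA|/ht].
- by move=> x r; exists (TVar (r x)).
- move=> x A IA r; have [x' [A' [<- hA]]] := eb x A r IA.
  by exists (TIota x' A').
Qed.

(** * The nameless calculus *)

Variable L : eqType.

Local Notation rexpr := (@rexpr sg V L).
Local Notation lexpr := (@lexpr sg V L).
Local Notation sequent := (@sequent sg V L).

Inductive nexpr (X : Type) :=
| NLab (w : L) (A : nform X)
| NDen (t : nterm X) (x : X) (w : L)
| NDom (x : X) (w : L)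
| NRel (w v : L).

(** An expression over [option X] is a context with hole [None]; the expressions E[y/x] and E[z/x]
    of [Repl] are two fillings of one context. *)
Definition inst_expr X (y : X) (e : nexpr (option X)) : nexpr X :=
  match e with
  | NLab w A => NLab w (inst y A)
  | NDen t x w => NDen (nmap_term (odflt y) t) (odflt y x) w
  | NDom x w => NDom (odflt y x) w
  | NRel w v => NRel X w v
  end.

(** The label map s does for eigenlabels what r does for eigenvariables: varying it yields the
    premisses for all their values. *)
Definition tr_rexpr X (r : V -> X) (s : L -> L) (e : rexpr) : nexpr X :=
  match e with
  | Lab w A => NLab (s w) (tr_form r A)
  | Den t x w => NDen (tr_term r t) (r x) (s w)
  end.

Definition tr_lexpr X (r : V -> X) (s : L -> L) (e : lexpr) : nexpr X :=
  match e with
  | Both e => tr_rexpr r s e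
  | Dom x w => NDom (r x) (s w)
  | Rel w v => NRel X (s w) (s v)
  end.

(* A sequent becomes one list, the boolean telling the two sides apart. *)
Local Notation nseq := (seq (bool * nexpr V)).
Local Notation lft e := (true, e).
Local Notation rgt e := (false, e).

Definition tr_seq (r : V -> V) (s : L -> L) (T : sequent) : nseq :=
  [seq lft (tr_lexpr r s e) | e <- T.1] ++ [seq rgt (tr_rexpr r s e) | e <- T.2].

Inductive nreplaceable X (w : L) : nexpr X -> Prop :=
| NReplDen a b : nreplaceable w (NDen (NVar a) b w)
| NReplDom a : nreplaceable w (NDom a w)
| NReplAtom p : natomic p -> nreplaceable w (NLab w p).

Variable N : nonlogical_rule -> Prop.

(* [nrule prin prems]: a rule with principal expressions [prin]; [prems] holds
   the list of the new expressions of each premiss, with one premiss for every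
   possible value of an eigenvariable. *)
Inductive nrule : nseq -> (nseq -> Prop) -> Prop :=
| NInitAtom w p : natomic p ->
    nrule [:: lft (NLab w p); rgt (NLab w p)] (fun _ => False)
| NInitDen w x y :
    nrule [:: lft (NDen (NVar y) x w); rgt (NDen (NVar y) x w)] (fun _ => False)
| NInitBot w : nrule [:: lft (NLab w (NBot V))] (fun _ => False)
| NLAnd w A B :
    nrule [:: lft (NLab w (NAnd A B))] (eq [:: lft (NLab w A); lft (NLab w B)])
| NRAnd w A B :
    nrule [:: rgt (NLab w (NAnd A B))]
          (fun p => p = [:: rgt (NLab w A)] \/ p = [:: rgt (NLab w B)])
| NLOr w A B :
    nrule [:: lft (NLab w (NOr A B))]
          (fun p => p = [:: lft (NLab w A)] \/ p = [:: lft (NLab w B)])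
| NROr w A B :
    nrule [:: rgt (NLab w (NOr A B))] (eq [:: rgt (NLab w A); rgt (NLab w B)])
| NLImp w A B :
    nrule [:: lft (NLab w (NImp A B))]
          (fun p => p = [:: rgt (NLab w A)] \/ p = [:: lft (NLab w B)])
| NRImp w A B :
    nrule [:: rgt (NLab w (NImp A B))] (eq [:: lft (NLab w A); rgt (NLab w B)])
| NLAll w y A :
    nrule [:: lft (NDom y w); lft (NLab w (NAll A))] (eq [:: lft (NLab w (inst y A))])
| NRAll w A :
    nrule [:: rgt (NLab w (NAll A))]
          (fun p => exists z, p = [:: lft (NDom z w); rgt (NLab w (inst z A))])
| NLEx w A :
    nrule [:: lft (NLab w (NEx A))]
          (fun p => exists z, p = [:: lft (NDom z w); lft (NLab w (inst z A))])
| NREx w y A :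
    nrule [:: lft (NDom y w); rgt (NLab w (NEx A))] (eq [:: rgt (NLab w (inst y A))])
| NLBox w v A :
    nrule [:: lft (NRel V w v); lft (NLab w (NBox A))] (eq [:: lft (NLab v A)])
| NRBox w A :
    nrule [:: rgt (NLab w (NBox A))]
          (fun p => exists u, p = [:: lft (NRel V w u); rgt (NLab u A)])
| NLDia w A :
    nrule [:: lft (NLab w (NDia A))]
          (fun p => exists u, p = [:: lft (NRel V w u); lft (NLab u A)])
| NRDia w v A :
    nrule [:: lft (NRel V w v); rgt (NLab w (NDia A))] (eq [:: rgt (NLab v A)])
| NRefEq w x : nrule [::] (eq [:: lft (NLab w (NEq x x))])
| NRigVar w v y z :
    nrule [:: lft (NLab w (NEq y z))] (eq [:: lft (NLab v (NEq y z))])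
| NRepl w y z E : nreplaceable w E ->
    nrule [:: lft (inst_expr y E); lft (NLab w (NEq y z))] (eq [:: lft (inst_expr z E)])
| NLLam w A t :
    nrule [:: lft (NLab w (NLam A t))]
          (fun p => exists z, p = [:: lft (NDen t z w); lft (NLab w (inst z A))])
| NRLam w y A t :
    nrule [:: rgt (NLab w (NLam A t))]
          (fun p => p = [:: rgt (NDen t y w)] \/ p = [:: rgt (NLab w (inst y A))])
| NLD1 w x A :
    nrule [:: lft (NDen (NIota A) x w)] (eq [:: lft (NLab w (inst x A))])
| NLD2 w x y A :
    nrule [:: lft (NDen (NIota A) x w)]
          (fun p => p = [:: rgt (NLab w (inst y A))] \/ p = [:: lft (NLab w (NEq x y))])
| NRD w x A :
    nrule [:: rgt (NDen (NIota A) x w)]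
          (fun p => p = [:: rgt (NLab w (inst x A))] \/
             exists z, p = [:: lft (NLab w (inst z A)); rgt (NLab w (NEq x z))])
| NDenVar w x : nrule [::] (eq [:: lft (NDen (NVar x) x w)])
| NDenId w x y :
    nrule [:: lft (NDen (NVar y) x w)] (eq [:: lft (NLab w (NEq y x))])
| NRefW w : N RefW -> nrule [::] (eq [:: lft (NRel V w w)])
| NSer w : N Ser -> nrule [::] (fun p => exists u, p = [:: lft (NRel V w u)])
(* In [RuleSer] the fresh label may coincide with w, if w is itself fresh. *)
| NSer_diag : N Ser -> nrule [::] (fun p => exists u, p = [:: lft (NRel V u u)])
| NTrans w v u : N Trans ->
    nrule [:: lft (NRel V w v); lft (NRel V v u)] (eq [:: lft (NRel V w u)])
| NEucl w v u : N Eucl ->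
    nrule [:: lft (NRel V w v); lft (NRel V w u)] (eq [:: lft (NRel V v u)])
| NEuclc w v : N Eucl -> nrule [:: lft (NRel V w v)] (eq [:: lft (NRel V v v)])
| NIncr w v x : N Incr ->
    nrule [:: lft (NDom x w); lft (NRel V w v)] (eq [:: lft (NDom x v)])
| NDecr w v x : N Decr ->
    nrule [:: lft (NDom x v); lft (NRel V w v)] (eq [:: lft (NDom x w)])
| NCons w x : N Defs.Cons -> nrule [::] (eq [:: lft (NDom x w)]).

(** The index bounds the height, so infinitely many premisses call for no supremum; [False] at 0
    reflects that a leaf has height 1. Membership of [prin] and its survival in the premisses make S
    behave as a set. *)
Fixpoint nderiv (n : nat) (S : nseq) : Prop :=
  if n is m.+1 then
    exists prin prems, [/\ nrule prin prems, incl prin S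
      & forall p, prems p -> nderiv m (p ++ S)]
  else False.

(** Weakening, exchange and contraction at once. No eigenvariable can clash with the added
    expressions, as premisses exist for all its values. *)
Lemma nderiv_incl n S S' : incl S S' -> nderiv n S -> nderiv n S'.
Proof.
elim: n S S' => //= n IH S S' SS [prin [prems [R h hp]]].
exists prin, prems; split=> //; first by move=> e /h/SS.
move=> p /hp; apply: IH => e; rewrite !In_cat; case; auto.
Qed.

Lemma nderivS n S : nderiv n S -> nderiv n.+1 S.
Proof.
elim: n S => // n IH S [prin [prems [R h hp]]].
by exists prin, prems; split=> // p /hp/IH.
Qed.

(* Invertibility, in the form in which it lets one drop [E]: as [S] contains a
   premiss of every rule with principal expression [E], such rules are idle. *)
Lemma nderiv_drop n E S :
  (forall prin prems, nrule prin prems -> In E prin ->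
     exists2 p, prems p & incl p S) ->
  nderiv n (E :: S) -> nderiv n S.
Proof.
elim: n S => // n IH S hE [prin [prems [R h hp]]].
(* Proved along the list [prin], since expressions have no decidable equality: predicate letters
   form an arbitrary type. *)
have [/(hE _ _ R) [p pp pS]|h'] : In E prin \/ incl prin S.
  elim: prin {R} h => [|a s IHs] h; first by right.
  have [|i|i] := IHs; [by move=> e ie; apply: h; right|by left; right|].
  have [<-|aS] := h a (or_introl erefl); first by left; left.
  by right=> e [<-|/i].
(* E is principal, but the premiss p adds nothing to S, so the last step is skipped. *)
- apply: nderivS; apply: IH hE _; apply: nderiv_incl (hp _ pp).
  by move=> e; rewrite In_cat; case=> // /pS; right.
- exists prin, prems; split=> // p pp; apply: IH.
    move=> ? ? R' i; have [q qq qS] := hE _ _ R' i; exists q => //.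
    by move=> e /qS; rewrite In_cat; right.
  apply: nderiv_incl (hp _ pp) => e; rewrite /= !In_cat /=; tauto.
Qed.

(** * From named to nameless derivations *)

Definition upd (T : eqType) X (f : T -> X) (a : T) (b : X) (x : T) : X :=
  if x == a then b else f x.

Lemma upd_notin (T : eqType) X (f : T -> X) a b (s : seq T) :
  a \notin s -> {in s, upd f a b =1 f}.
Proof. by move=> a_s x xs; rewrite /upd; case: eqP => // xa; rewrite -xa xs in a_s. Qed.

Lemma mem_flatten_map T (U : eqType) (f : T -> seq U) x s :
  x \in flatten (map f s) <-> exists2 e, In e s & x \in f e.
Proof.
elim: s => [|a s IH] /=; first by split=> // -[].
rewrite mem_cat; split.
- by case/orP => [xa|/IH[e es xe]]; [exists a; auto|exists e; auto].
- by case=> e [<- ->//|es xe]; apply/orP; right; apply/IH; exists e.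
Qed.

Lemma notin_flatten_map T (U : eqType) (f : T -> seq U) x s e :
  x \notin flatten (map f s) -> In e s -> x \notin f e.
Proof. by move=> h es; apply: contra h => xe; apply/mem_flatten_map; exists e. Qed.

Lemma fresh_varl z (T : sequent) e : fresh_var z T -> In e T.1 ->
  z \notin fv_lexpr e /\ z \notin bv_lexpr e.
Proof.
rewrite /fresh_var /fv_sequent /bv_sequent !mem_cat !negb_or.
by case/andP=> /andP[h _] /andP[h' _] eT; split; apply: notin_flatten_map eT.
Qed.

Lemma fresh_varr z (T : sequent) e : fresh_var z T -> In e T.2 ->
  z \notin fv_rexpr e /\ z \notin bv_rexpr e.
Proof.
rewrite /fresh_var /fv_sequent /bv_sequent !mem_cat !negb_or.
by case/andP=> /andP[_ h] /andP[_ h'] eT; split; apply: notin_flatten_map eT.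
Qed.

Lemma fresh_labell u (T : sequent) e : fresh_label u T -> In e T.1 ->
  u \notin labels_lexpr e.
Proof.
rewrite /fresh_label /labels_sequent mem_cat negb_or => /andP[h _].
exact: notin_flatten_map.
Qed.

Lemma fresh_labelr u (T : sequent) e : fresh_label u T -> In e T.2 ->
  u \notin labels_rexpr e.
Proof.
rewrite /fresh_label /labels_sequent mem_cat negb_or => /andP[_ h].
exact: notin_flatten_map.
Qed.

Lemma tr_rexpr_ext X (r r' : V -> X) (s s' : L -> L) e :
  {in fv_rexpr e, r =1 r'} -> {in labels_rexpr e, s =1 s'} ->
  tr_rexpr r s e = tr_rexpr r' s' e.
Proof.
case: e => [w A|t x w] /= hr hs; rewrite (hs w) ?inE //.
  by rewrite ((proj1 tr_ext) _ _ _ _ hr).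
rewrite (hr x) ?mem_rcons ?inE ?eqxx // ((proj2 tr_ext) _ _ r r') // => z zt.
by apply: hr; rewrite mem_rcons inE zt orbT.
Qed.

Lemma tr_lexpr_ext X (r r' : V -> X) (s s' : L -> L) e :
  {in fv_lexpr e, r =1 r'} -> {in labels_lexpr e, s =1 s'} ->
  tr_lexpr r s e = tr_lexpr r' s' e.
Proof.
case: e => [e|x w|w v] /= hr hs; first exact: tr_rexpr_ext.
- by rewrite hr ?hs ?inE.
- by rewrite !hs ?inE ?eqxx ?orbT.
Qed.

Lemma map_eq_In T U (f g : T -> U) s :
  (forall x, In x s -> f x = g x) -> map f s = map g s.
Proof. exact: map_ext_in. Qed.

(** The use of freshness: the value of an eigenvariable can be changed at will while the conclusion
    keeps its translation. *)
Lemma tr_seq_upd_var r s z z' T : fresh_var z T ->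
  tr_seq (upd r z z') s T = tr_seq r s T.
Proof.
move=> fz; congr cat; apply: map_eq_In => e eT; congr pair.
- apply: tr_lexpr_ext => //; apply: upd_notin.
  exact: (proj1 (fresh_varl fz eT)).
- apply: tr_rexpr_ext => //; apply: upd_notin.
  exact: (proj1 (fresh_varr fz eT)).
Qed.

Lemma tr_seq_upd_label r s u u' T : fresh_label u T ->
  tr_seq r (upd s u u') T = tr_seq r s T.
Proof.
move=> fu; congr cat; apply: map_eq_In => e eT; congr pair.
- apply: tr_lexpr_ext => //; apply: upd_notin; exact: fresh_labell eT.
- apply: tr_rexpr_ext => //; apply: upd_notin; exact: fresh_labelr eT.
Qed.

(** Makes the active formula of a named premiss with eigenvariable z into the nameless instance at
    an arbitrary value z'. *)
Lemma tr_inst_fresh (r : V -> V) z z' x A :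
  z \notin [seq y <- fv_form A | y != x] -> z \notin bv_form A ->
  tr_form (upd r z z') (subst_form z x A) = inst z' (tr_form (bind r x) A).
Proof.
move=> zf zb; rewrite tr_inst; last exact: (proj1 (free_for_bv _ _)).
rewrite {1}/upd eqxx; congr inst; apply: (proj1 tr_ext); apply: bind_ext.
exact: upd_notin.
Qed.

(** The context is obtained by sending x to the hole. It does not depend on y, so it serves both
    expressions of [Repl]. *)
Lemma tr_replaceable (r : V -> V) (s : L -> L) w y x (E : lexpr) :
  replaceable w E ->
  nreplaceable (s w) (tr_lexpr (bind r x) s E) /\
  tr_lexpr r s (subst_lexpr y x E) = inst_expr (r y) (tr_lexpr (bind r x) s E).
Proof.
have eb v : odflt (r y) (bind r x v) = r (subst_var y x v).
  by rewrite /bind /subst_var; case: eqP.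
case=> [a b|a|p] /=.
- by rewrite !eb; split=> //; constructor.
- by rewrite eb; split=> //; constructor.
- case: p => //= *; (split; first by constructor).
    by rewrite /inst /= -!map_comp; congr NLab; congr NPred; apply: eq_map => v /=; rewrite eb.
  by rewrite /inst /= !eb.
Qed.

Ltac incl_tac := let e := fresh in
  move=> e; rewrite /tr_seq /= ?In_cat /= ?In_cat /=; tauto.

Ltac incl_prin :=
  rewrite /tr_seq /=;
  repeat (apply: incl_cons;
    first by repeat first [left; reflexivity | right | apply/In_cat; right]);
  exact: incl_nil_l.

Ltac use_rule R :=
  eexists; eexists; split; [apply: R|incl_prin|];
  let p := fresh "p" in move=> p /=.

(** Assuming the premiss under all r and s supplies every nameless premiss: for the value z' of an
    eigenvariable z, take [upd r z z'], and likewise for labels. Principal expressions that the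
    named rule consumes are put back by weakening. *)
Lemma nderiv_rule1 n T1 T : rule1 N T1 T ->
  (forall r s, nderiv n (tr_seq r s T1)) -> forall r s, nderiv n.+1 (tr_seq r s T).
Proof.
case=> {T1 T}.
- move=> w A B Γ Δ IH r s; use_rule NLAnd => <-; apply: nderiv_incl (IH r s); incl_tac.
- move=> w A B Γ Δ IH r s; use_rule NROr => <-; apply: nderiv_incl (IH r s); incl_tac.
- move=> w A B Γ Δ IH r s; use_rule NRImp => <-; apply: nderiv_incl (IH r s); incl_tac.
- move=> w x y A Γ Δ fy IH r s; use_rule (NLAll (s w) (r y) (tr_form (bind r x) A)) => <-.
  rewrite -tr_inst //; apply: nderiv_incl (IH r s); incl_tac.
- move=> w x z A Γ Δ fz IH r s; use_rule NRAll => -[z' ->].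
  have [zf] := fresh_varr fz (or_introl erefl).
  rewrite /= inE negb_or => /andP[_ zb].
  move: (IH (upd r z z') s); rewrite -(tr_seq_upd_var r s z' fz) -(tr_inst_fresh _ _ zf zb).
  apply: nderiv_incl; rewrite /tr_seq /= {1}/upd eqxx; incl_tac.
- move=> w x z A Γ Δ fz IH r s; use_rule NLEx => -[z' ->].
  have [zf] := fresh_varl fz (or_introl erefl).
  rewrite /= inE negb_or => /andP[_ zb].
  move: (IH (upd r z z') s); rewrite -(tr_seq_upd_var r s z' fz) -(tr_inst_fresh _ _ zf zb).
  apply: nderiv_incl; rewrite /tr_seq /= {1}/upd eqxx; incl_tac.
- move=> w x y A Γ Δ fy IH r s; use_rule (NREx (s w) (r y) (tr_form (bind r x) A)) => <-.
  rewrite -tr_inst //; apply: nderiv_incl (IH r s); incl_tac.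
- move=> w v A Γ Δ IH r s; use_rule (NLBox (s w) (s v)) => <-;
    apply: nderiv_incl (IH r s); incl_tac.
- move=> w u A Γ Δ fu IH r s; use_rule NRBox => -[u' ->].
  move: (IH r (upd s u u')); rewrite -(tr_seq_upd_label r s u' fu).
  have := fresh_labelr fu (or_introl erefl); rewrite inE eq_sym => uw.
  apply: nderiv_incl; rewrite /tr_seq /= /upd (negPf uw) eqxx; incl_tac.
- move=> w u A Γ Δ fu IH r s; use_rule NLDia => -[u' ->].
  move: (IH r (upd s u u')); rewrite -(tr_seq_upd_label r s u' fu).
  have := fresh_labell fu (or_introl erefl); rewrite inE eq_sym => uw.
  apply: nderiv_incl; rewrite /tr_seq /= /upd (negPf uw) eqxx; incl_tac.
- move=> w v A Γ Δ IH r s; use_rule (NRDia (s w) (s v)) => <-;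
    apply: nderiv_incl (IH r s); incl_tac.
- move=> w x Γ Δ IH r s; use_rule (NRefEq (s w) (r x)) => <-;
    apply: nderiv_incl (IH r s); incl_tac.
- move=> w v y z Γ Δ IH r s; use_rule (NRigVar (s w) (s v) (r y) (r z)) => <-;
    apply: nderiv_incl (IH r s); incl_tac.
- move=> w x y z E Γ Δ hE IH r s.
  have [rE ey] := tr_replaceable r s y x hE.
  have [_ ez] := tr_replaceable r s z x hE.
  eexists; eexists; split; [exact: (NRepl (r y) (r z) rE)|rewrite -ey; incl_tac|].
  move=> p <-; rewrite -ez; apply: nderiv_incl (IH r s); incl_tac.
- move=> w x z t B Γ Δ fz IH r s; use_rule NLLam => -[z' ->].
  have [] := fresh_varl fz (or_introl erefl).
  rewrite /= inE !mem_cat !negb_or => /andP[zf zt] /and3P[_ zb _].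
  move: (IH (upd r z z') s); rewrite -(tr_seq_upd_var r s z' fz) -(tr_inst_fresh _ _ zf zb).
  have -> : tr_term r t = tr_term (upd r z z') t.
    by apply: (proj2 tr_ext) => v vt; rewrite (upd_notin r z' zt).
  apply: nderiv_incl; rewrite /tr_seq /=.
  have -> : upd r z z' z = z' by rewrite /upd eqxx.
  incl_tac.
- move=> w x y A Γ Δ fy IH r s; use_rule (NLD1 (s w) (r y) (tr_form (bind r x) A)) => <-.
  rewrite -tr_inst //; apply: nderiv_incl (IH r s); incl_tac.
- move=> w x Γ Δ IH r s; use_rule (NDenVar (s w) (r x)) => <-;
    apply: nderiv_incl (IH r s); incl_tac.
- move=> w x y Γ Δ IH r s; use_rule (NDenId (s w) (r x) (r y)) => <-;
    apply: nderiv_incl (IH r s); incl_tac.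
- move=> w Γ Δ nN IH r s; use_rule (NRefW (s w) nN) => <-; apply: nderiv_incl (IH r s); incl_tac.
- move=> w u Γ Δ nN fu IH r s; case: (eqVneq w u) => [wu|wu].
    subst w; use_rule (NSer_diag nN) => -[u' ->].
    move: (IH r (upd s u u')); rewrite -(tr_seq_upd_label r s u' fu).
    by apply: nderiv_incl; rewrite /tr_seq /= {1 2}/upd eqxx; incl_tac.
  use_rule (NSer (s w) nN) => -[u' ->].
  move: (IH r (upd s u u')); rewrite -(tr_seq_upd_label r s u' fu).
  by apply: nderiv_incl; rewrite /tr_seq /= {1 2}/upd eqxx (negPf wu); incl_tac.
- move=> w v u Γ Δ nN IH r s; use_rule (NTrans (s w) (s v) (s u) nN) => <-;
    apply: nderiv_incl (IH r s); incl_tac.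
- move=> w v u Γ Δ nN IH r s; use_rule (NEucl (s w) (s v) (s u) nN) => <-;
    apply: nderiv_incl (IH r s); incl_tac.
- move=> w v Γ Δ nN IH r s; use_rule (NEuclc (s w) (s v) nN) => <-;
    apply: nderiv_incl (IH r s); incl_tac.
- move=> w v x Γ Δ nN IH r s; use_rule (NIncr (s w) (s v) (r x) nN) => <-;
    apply: nderiv_incl (IH r s); incl_tac.
- move=> w v x Γ Δ nN IH r s; use_rule (NDecr (s w) (s v) (r x) nN) => <-;
    apply: nderiv_incl (IH r s); incl_tac.
- move=> w x Γ Δ nN IH r s; use_rule (NCons (s w) (r x) nN) => <-;
    apply: nderiv_incl (IH r s); incl_tac.
Qed.

Lemma nderiv_rule2 n T1 T2 T : rule2 T1 T2 T ->
  (forall r s, nderiv n (tr_seq r s T1)) -> (forall r s, nderiv n (tr_seq r s T2)) ->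
  forall r s, nderiv n.+1 (tr_seq r s T).
Proof.
case=> {T1 T2 T}.
- move=> w A B Γ Δ I1 I2 r s; use_rule NRAnd => -[] ->.
    by apply: nderiv_incl (I1 r s); incl_tac.
  by apply: nderiv_incl (I2 r s); incl_tac.
- move=> w A B Γ Δ I1 I2 r s; use_rule NLOr => -[] ->.
    by apply: nderiv_incl (I1 r s); incl_tac.
  by apply: nderiv_incl (I2 r s); incl_tac.
- move=> w A B Γ Δ I1 I2 r s; use_rule NLImp => -[] ->.
    by apply: nderiv_incl (I1 r s); incl_tac.
  by apply: nderiv_incl (I2 r s); incl_tac.
- move=> w x y t B Γ Δ fy I1 I2 r s.
  use_rule (NRLam (s w) (r y) (tr_form (bind r x) B) (tr_term r t)) => -[] ->.
    by apply: nderiv_incl (I1 r s); incl_tac.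
  by rewrite -tr_inst //; apply: nderiv_incl (I2 r s); incl_tac.
- move=> w x1 x2 y A Γ Δ fy I1 I2 r s.
  use_rule (NLD2 (s w) (r x2) (r y) (tr_form (bind r x1) A)) => -[] ->.
    by rewrite -tr_inst //; apply: nderiv_incl (I1 r s); incl_tac.
  by apply: nderiv_incl (I2 r s); incl_tac.
- move=> w x1 x2 z A Γ Δ fx fz I1 I2 r s.
  use_rule (NRD (s w) (r x2) (tr_form (bind r x1) A)) => -[->|[z' ->]].
    by rewrite -tr_inst //; apply: nderiv_incl (I1 r s); incl_tac.
  have [] := fresh_varr fz (or_introl erefl).
  rewrite /= inE mem_rcons inE !negb_or => /andP[zx zf] /andP[_ zb].
  move: (I2 (upd r z z') s); rewrite -(tr_seq_upd_var r s z' fz) -(tr_inst_fresh _ _ zf zb).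
  apply: nderiv_incl; rewrite /tr_seq /=.
  have -> : upd r z z' z = z' by rewrite /upd eqxx.
  have -> : upd r z z' x2 = r x2 by rewrite /upd eq_sym (negPf zx).
  incl_tac.
Qed.

Lemma tr_seq_perm r s T T' : same_sequent T T' ->
  Permutation (tr_seq r s T) (tr_seq r s T').
Proof. by case=> h1 h2; apply: Permutation_app; apply: Permutation_map. Qed.

Lemma nderiv_leq m n S : m <= n -> nderiv m S -> nderiv n S.
Proof. by move/subnK <-; elim: (n - m) => // k IH /IH; apply: nderivS. Qed.

(** Each named rule costs one nameless step, and permuting a multiset costs none. *)
Lemma derives_nderiv h T : derives N h T -> forall r s, nderiv h (tr_seq r s T).
Proof.
have perm n T0 T' : same_sequent T0 T' -> (forall r s, nderiv n (tr_seq r s T0)) ->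
    forall r s, nderiv n (tr_seq r s T').
  move=> TT IH r s; apply: nderiv_incl (IH r s) => e.
  exact: Permutation_in (tr_seq_perm _ _ TT).
elim=> {h T}.
- move=> T0 T i0 TT _; apply: (perm 1) TT _ => r s; case: i0.
  + move=> w p Γ Δ ap; have ap' : natomic (tr_form r p) by case: p ap.
    by use_rule (NInitAtom (s w) ap').
  + by move=> w x y Γ Δ; use_rule (NInitDen (s w) (r x) (r y)).
  + by move=> w Γ Δ; use_rule (NInitBot (s w)).
- move=> h T1 T0 T R TT _ _ IH; apply: perm TT _; exact: nderiv_rule1 R IH.
- move=> h1 h2 T1 T2 T0 T R TT _ _ I1 _ I2; apply: perm TT _.
  apply: nderiv_rule2 R _ _ => r s.
    exact: nderiv_leq (leq_maxl _ _) (I1 r s).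
  exact: nderiv_leq (leq_maxr _ _) (I2 r s).
Qed.

(** * From nameless to named derivations *)

Definition nfv_expr (e : nexpr V) : seq V :=
  match e with
  | NLab _ A => nfv_form A
  | NDen t x _ => rcons (nfv_term t) x
  | NDom x _ => [:: x]
  | NRel _ _ => [::]
  end.

Definition nlabels_expr (e : nexpr V) : seq L :=
  match e with
  | NLab w _ | NDen _ _ w | NDom _ w => [:: w]
  | NRel w v => [:: w; v]
  end.

Definition nfv_seq (S : nseq) := flatten [seq nfv_expr e.2 | e <- S].
Definition nlabels_seq (S : nseq) := flatten [seq nlabels_expr e.2 | e <- S].

Lemma nfv_tr_form A : {subset fv_form A <= nfv_form (tr_form id A)}.
Proof. by move=> x /(proj1 nfv_tr _ _ id)/In_mem. Qed.

Lemma nfv_tr_term t : {subset fv_term t <= nfv_term (tr_term id t)}.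
Proof. by move=> x /(proj2 nfv_tr _ _ id)/In_mem. Qed.

Lemma nfv_tr_rexpr e : {subset fv_rexpr e <= nfv_expr (tr_rexpr id id e)}.
Proof.
case: e => [w A|t x w] z /=; first exact: nfv_tr_form.
by rewrite !mem_rcons !inE => /orP[->//|/nfv_tr_term->]; rewrite orbT.
Qed.

Lemma nfv_tr_seq T S : Permutation (tr_seq id id T) S ->
  {subset fv_sequent T <= nfv_seq S}.
Proof.
move=> p x; rewrite /fv_sequent mem_cat => /orP[] /mem_flatten_map[e eT xe];
  apply/mem_flatten_map.
- exists (lft (tr_lexpr id id e)).
    by apply: (Permutation_in _ p); apply/In_cat; left; apply/In_map; exists e.
  by case: e xe {eT} => //= e; apply: nfv_tr_rexpr.
- exists (rgt (tr_rexpr id id e)); last exact: nfv_tr_rexpr.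
  by apply: (Permutation_in _ p); apply/In_cat; right; apply/In_map; exists e.
Qed.

Lemma nlabels_tr_seq T S : Permutation (tr_seq id id T) S ->
  {subset labels_sequent T <= nlabels_seq S}.
Proof.
move=> p x; rewrite /labels_sequent mem_cat => /orP[] /mem_flatten_map[e eT xe];
  apply/mem_flatten_map.
- exists (lft (tr_lexpr id id e)).
    by apply: (Permutation_in _ p); apply/In_cat; left; apply/In_map; exists e.
  by case: e xe {eT} => [[]|x'|] .
- exists (rgt (tr_rexpr id id e)); last by case: e xe {eT}.
  by apply: (Permutation_in _ p); apply/In_cat; right; apply/In_map; exists e.
Qed.

Lemma same_sequent_bv (T T' : sequent) :
  same_sequent T T' -> {subset bv_sequent T <= bv_sequent T'}.
Proof.
case=> h1 h2 x; rewrite /bv_sequent !mem_cat => /orP[] /mem_flatten_map[e eT xe];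
  apply/orP; [left|right]; apply/mem_flatten_map; exists e => //.
- exact: Permutation_in h1 eT.
- exact: Permutation_in h2 eT.
Qed.

(** A rule whose active expressions gain no bound variable upwards passes to its premiss whatever
    the binders of its conclusion avoid. *)
Lemma bv_sequent_catr (els els' Γ : seq lexpr) (ers ers' Δ : seq rexpr) :
  {subset bv_sequent (els', ers') <= bv_sequent (els, ers)} ->
  {subset bv_sequent (els' ++ Γ, ers' ++ Δ) <= bv_sequent (els ++ Γ, ers ++ Δ)}.
Proof.
have bvE ls rs x : (x \in bv_sequent (ls ++ Γ, rs ++ Δ)) =
    (x \in bv_sequent (ls, rs)) || (x \in bv_sequent (Γ, Δ)).
  by rewrite /bv_sequent /= !map_cat !flatten_cat !mem_cat orbACA.
by move=> sub x; rewrite !bvE => /orP[/sub->//|->]; rewrite orbT.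
Qed.

(* A derivation uses finitely many variables; any nameless sequent can be named
   back as soon as the bound variables avoid all of them, which keeps every
   sequent of the derivation pure and every substitution capture-free. *)
Definition realizable n (S : nseq) := exists F : seq V, forall T,
  Permutation (tr_seq id id T) S -> {in bv_sequent T, forall x, x \notin F} ->
  exists2 h, h <= n & derives N h T.

Lemma realizable_perm n S S' : Permutation S S' -> realizable n S -> realizable n S'.
Proof.
move=> p [F hF]; exists F => T pT; apply: hF.
exact: Permutation_trans pT (Permutation_sym p).
Qed.

Lemma realizableS n S : realizable n S -> realizable n.+1 S.
Proof.
case=> F hF; exists F => T pT /(hF T pT)[h hn d].
by exists h => //; apply: leqW.
Qed.

Definition lfts := map (pair true : nexpr V -> _).
Definition rgts := map (pair false : nexpr V -> _).

(** Locates the active expressions of a nameless rule in a naming T, removing one occurrence at a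
    time. They are determined only up to alphabetic variants, so a rule has to be imitated for all
    their namings. *)
Lemma tr_seq_pull T (ls rs : seq (nexpr V)) S :
  Permutation (tr_seq id id T) (lfts ls ++ rgts rs ++ S) ->
  exists els ers Γ Δ,
    [/\ map (tr_lexpr id id) els = ls, map (tr_rexpr id id) ers = rs,
        same_sequent (els ++ Γ, ers ++ Δ) T & Permutation (tr_seq id id (Γ, Δ)) S].
Proof.
case: T => Γ Δ; elim: ls Γ => [|l ls IH] Γ.
  elim: rs Δ => [|r rs IH] Δ /= p; first by exists [::], [::], Γ, Δ.
  have : In (rgt r) (tr_seq id id (Γ, Δ)).
    by apply: Permutation_in (Permutation_sym p) _; left.
  case/In_cat => /In_map[e [] //= [er] /(in_split e)[D1 [D2 eD]]].
  case: (IH (D1 ++ D2)).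
    apply: (@Permutation_cons_inv _ _ _ (rgt r)); apply: Permutation_trans p.
    rewrite /tr_seq eD /= -er -[app _ _]/(D1 ++ e :: D2) !map_cat /= catA
      [in X in Permutation _ X]catA.
    exact: Permutation_middle.
  move=> els [ers [Γ' [Δ' [e1 e2 [s1 s2] p']]]].
  exists els, (e :: ers), Γ', Δ'; split; rewrite /= ?er ?e2 //; split=> //=.
  rewrite eD; apply: Permutation_trans (Permutation_middle _ _ _).
  exact: perm_skip.
move=> /= p; have : In (lft l) (tr_seq id id (Γ, Δ)).
  by apply: Permutation_in (Permutation_sym p) _; left.
case/In_cat => /In_map[e [] //= [er] /(in_split e)[D1 [D2 eD]]].
case: (IH (D1 ++ D2)).
  apply: (@Permutation_cons_inv _ _ _ (lft l)); apply: Permutation_trans p.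
  rewrite /tr_seq eD /= -er -[app _ _]/(D1 ++ e :: D2) !map_cat /= -!catA /=.
  exact: Permutation_middle.
move=> els [ers [Γ' [Δ' [e1 e2 [s1 s2] p']]]].
exists (e :: els), ers, Γ', Δ'; split; rewrite /= ?er ?e1 //; split=> //=.
rewrite eD; apply: Permutation_trans (Permutation_middle _ _ _).
exact: perm_skip.
Qed.

Lemma tr_seq_cat els ers Γ Δ S : Permutation (tr_seq id id (Γ, Δ)) S ->
  Permutation (tr_seq id id (els ++ Γ, ers ++ Δ))
    (lfts (map (tr_lexpr id id) els) ++ rgts (map (tr_rexpr id id) ers) ++ S).
Proof.
move=> p; rewrite /tr_seq /= !map_cat -!catA /lfts /rgts -!map_comp.
apply: Permutation_app_head.
apply: Permutation_trans (Permutation_app_head _ p); rewrite /tr_seq /= -[app _ _]/(cat _ _) !catA.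
exact: (Permutation_app_tail _ (Permutation_app_comm _ _)).
Qed.

(** The free variables of T occur in S, and the bound ones avoid S. *)
Lemma realizable_pure T S F : Permutation (tr_seq id id T) S ->
  {in bv_sequent T, forall x, x \notin nfv_seq S ++ F} -> pure T.
Proof.
move=> p h x xf; apply/negP => /h; rewrite mem_cat negb_or => /andP[/negP[]].
by rewrite (nfv_tr_seq p xf).
Qed.

(* The hypotheses under which a nameless rule may be imitated by a named one;
   [F] lists the variables to be avoided by the bound variables. *)
Definition named_context F S (T : sequent) : Prop :=
  [/\ {in nfv_seq S ++ F, forall y, y \notin bv_sequent T},
      {in F, forall z, z \notin nfv_seq S -> fresh_var z T}
    & forall u, u \notin nlabels_seq S -> fresh_label u T].

Lemma named_contextP F S T T' : Permutation (tr_seq id id T) S ->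
  {in bv_sequent T', forall x, x \notin nfv_seq S ++ F} -> same_sequent T T' ->
  named_context F S T.
Proof.
move=> p h TT; have h' : {in bv_sequent T, forall x, x \notin nfv_seq S ++ F}.
  by move=> x /(same_sequent_bv TT)/h.
split.
- by move=> y yF; apply: contraL yF => /h'.
- move=> z zF zS; rewrite /fresh_var mem_cat negb_or.
  rewrite (contra (nfv_tr_seq p (x := z))) //=.
  by apply: contraL zF => /h'; rewrite mem_cat negb_or => /andP[].
- by move=> u; apply: contra; apply: nlabels_tr_seq.
Qed.

(** Reduces the imitation of a rule to its active expressions; the context, the multiset
    permutations, purity and the avoided variables are treated here once and for all. *)
Lemma realizable_rule1 n F ls rs S ls' rs' :
  realizable n (lfts ls' ++ rgts rs' ++ S) ->
  (forall els ers Γ Δ,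
     map (tr_lexpr id id) els = ls -> map (tr_rexpr id id) ers = rs ->
     named_context F (lfts ls ++ rgts rs ++ S) (els ++ Γ, ers ++ Δ) ->
     exists els' ers',
       [/\ map (tr_lexpr id id) els' = ls', map (tr_rexpr id id) ers' = rs',
           rule1 N (els' ++ Γ, ers' ++ Δ) (els ++ Γ, ers ++ Δ) &
           {subset bv_sequent (els', ers') <= bv_sequent (els, ers)}]) ->
  realizable n.+1 (lfts ls ++ rgts rs ++ S).
Proof.
(* [F1] serves the premiss, the free variables of the conclusion serve purity and capture-freeness,
   and F holds variables introduced by the rule itself. *)
move=> [F1 h1] hr; exists (F1 ++ (nfv_seq (lfts ls ++ rgts rs ++ S) ++ F)) => T p hF.
have [els [ers [Γ [Δ [el er TT pS]]]]] := tr_seq_pull p.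
have hF2 : {in bv_sequent T, forall x, x \notin nfv_seq (lfts ls ++ rgts rs ++ S) ++ F}.
  by move=> x /hF; rewrite mem_cat negb_or => /andP[].
have p0 := tr_seq_cat els ers pS; rewrite el er in p0.
have [els' [ers' [el' er' R sub]]] := hr _ _ Γ Δ el er (named_contextP p0 hF2 TT).
have [||h hn d] := h1 (els' ++ Γ, ers' ++ Δ).
- by rewrite -el' -er'; apply: tr_seq_cat.
- move=> x /(bv_sequent_catr sub)/(same_sequent_bv TT)/hF.
  by rewrite mem_cat negb_or => /andP[].
- exists h.+1 => //; apply: Der1 R TT _ d.
  exact: realizable_pure p hF2.
Qed.

Lemma realizable_rule2 n F ls rs S ls1 rs1 ls2 rs2 :
  realizable n (lfts ls1 ++ rgts rs1 ++ S) ->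
  realizable n (lfts ls2 ++ rgts rs2 ++ S) ->
  (forall els ers Γ Δ,
     map (tr_lexpr id id) els = ls -> map (tr_rexpr id id) ers = rs ->
     named_context F (lfts ls ++ rgts rs ++ S) (els ++ Γ, ers ++ Δ) ->
     exists els1 ers1 els2 ers2,
       [/\ map (tr_lexpr id id) els1 = ls1 /\ map (tr_rexpr id id) ers1 = rs1,
           map (tr_lexpr id id) els2 = ls2 /\ map (tr_rexpr id id) ers2 = rs2,
           rule2 (els1 ++ Γ, ers1 ++ Δ) (els2 ++ Γ, ers2 ++ Δ) (els ++ Γ, ers ++ Δ) &
           {subset bv_sequent (els1, ers1) ++ bv_sequent (els2, ers2)
              <= bv_sequent (els, ers)}]) ->
  realizable n.+1 (lfts ls ++ rgts rs ++ S).
Proof.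
move=> [F1 h1] [F2 h2] hr.
exists (F1 ++ F2 ++ (nfv_seq (lfts ls ++ rgts rs ++ S) ++ F)) => T p hF.
have [els [ers [Γ [Δ [el er TT pS]]]]] := tr_seq_pull p.
have hF' : {in bv_sequent T, forall x, x \notin nfv_seq (lfts ls ++ rgts rs ++ S) ++ F}.
  by move=> x /hF; rewrite 2!mem_cat !negb_or => /and3P[].
have p0 := tr_seq_cat els ers pS; rewrite el er in p0.
have [els1 [ers1 [els2 [ers2 [[el1 er1] [el2 er2] R sub]]]]] :=
  hr _ _ Γ Δ el er (named_contextP p0 hF' TT).
have sub' els' ers' : {subset bv_sequent (els', ers') <= bv_sequent (els, ers)} ->
    {subset bv_sequent (els' ++ Γ, ers' ++ Δ) <= bv_sequent T}.
  by move=> s x /(bv_sequent_catr s)/(same_sequent_bv TT).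
have [||a an d1] := h1 (els1 ++ Γ, ers1 ++ Δ).
- by rewrite -el1 -er1; apply: tr_seq_cat.
- move=> x xb; have /hF : x \in bv_sequent T.
    by apply: sub' xb => y yb; apply: sub; rewrite mem_cat yb.
  by rewrite !mem_cat !negb_or => /andP[].
have [||b bn d2] := h2 (els2 ++ Γ, ers2 ++ Δ).
- by rewrite -el2 -er2; apply: tr_seq_cat.
- move=> x xb; have /hF : x \in bv_sequent T.
    by apply: sub' xb => y yb; apply: sub; rewrite mem_cat yb orbT.
  by rewrite !mem_cat !negb_or => /and3P[].
exists (maxn a b).+1; first by rewrite ltnS geq_max an.
apply: Der2 R TT _ d1 d2; exact: realizable_pure p hF'.
Qed.

(** * Naming the principal expressions of a nameless rule *)

Lemma In_split1 T (e : T) S : In e S -> exists S0, Permutation S (e :: S0).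
Proof.
move=> eS; have [s1 [s2 ->]] := in_split e S eS; exists (s1 ++ s2).
exact/Permutation_sym/Permutation_middle.
Qed.

(** Nameless rules only ask for membership, so one occurrence may play both principal roles, whereas
    a named rule needs two occurrences. The first alternative is where contracted instances of rules
    arise. *)
Lemma In_split2 T (e f : T) S : In e S -> In f S ->
  e = f \/ exists S0, Permutation S (e :: f :: S0).
Proof.
move=> eS fS; have [S0 p] := In_split1 eS.
have [|fS0] := Permutation_in f p fS; first by left.
have [S1 p1] := In_split1 fS0.
right; exists S1; apply: Permutation_trans p _; exact: perm_skip.
Qed.

Lemma realizable_init n ls rs S :
  (forall els ers Γ Δ,
     map (tr_lexpr id id) els = ls -> map (tr_rexpr id id) ers = rs ->
     initial (els ++ Γ, ers ++ Δ)) ->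
  realizable n.+1 (lfts ls ++ rgts rs ++ S).
Proof.
move=> hi; exists (nfv_seq (lfts ls ++ rgts rs ++ S)) => T p hF.
have [els [ers [Γ [Δ [el er TT pS]]]]] := tr_seq_pull p.
exists 1 => //; apply: DerInit (hi _ _ Γ Δ el er) TT _.
by apply: (@realizable_pure T _ [::] p) => x; rewrite cats0; apply: hF.
Qed.

Lemma natomic_tr X (r : V -> X) A : natomic (tr_form r A) = atomic A.
Proof. by case: A. Qed.

(** Atomic formulas have no binders, hence no proper variants: the two sides of a named initial
    sequent carry literally the same atom. *)
Lemma tr_atomic_inj (A A' : form sg V) : natomic (tr_form id A) ->
  tr_form id A = tr_form id A' -> A = A'.
Proof.
case: A => //= [P xs|x y] _; case: A' => //=.
- move=> Q ys [PQ]; subst Q; rewrite !map_id => e; congr FPred; exact: val_inj.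
- by move=> x' y' [-> ->].
Qed.

(** A context is named by putting into its hole a variable x that does not occur in it; replacing x
    then fills the hole and touches nothing else. *)
Lemma nreplaceable_name w y z E : nreplaceable w E -> forall e : lexpr,
  tr_lexpr id id e = inst_expr y E ->
  exists x E', [/\ replaceable w E', subst_lexpr y x E' = e &
    tr_lexpr id id (subst_lexpr z x E') = inst_expr z E].
Proof.
have fr (s : seq (option V)) : exists x,
    forall v y, v \in s -> subst_var y x (odflt x v) = odflt y v.
  have [x xs] := infV (pmap id s); exists x => v y' vs; rewrite /subst_var.
  case: v vs => [v|] /= vs; last by rewrite eqxx.
  case: eqP => // vx; case/negP: xs; rewrite -vx; apply/In_mem/In_pmap; exact/In_mem.
case.
- move=> a b; case=> [[w' A'|[v|? ?] x' w']| |] //= [-> -> ->].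
  have [x hx] := fr [:: a; b].
  exists x, (Both (Den (TVar (odflt x a)) (odflt x b) w)).
  by split; [constructor|rewrite /= !hx ?inE ?eqxx ?orbT..].
- move=> a; case=> [[]|x' w'|] //= [-> ->].
  have [x hx] := fr [:: a].
  exists x, (Dom (odflt x a) w).
  by split; [constructor|rewrite /= !hx ?inE ?eqxx ?orbT..].
- case=> //= [P xs|a b] _; case=> [[w' A'|]| |] //= [->]; case: A' => //=.
    move=> Q ys [PQ]; subst Q; rewrite map_id => exs.
    have [x hx] := fr xs.
    (* The nameless list does not record its length; the tuple [ys] of the named expression supplies
       it. *)
    have sz : size (map (odflt x) xs) == arity P.
      by rewrite size_map -(size_map (odflt y)) -exs size_tuple.
    exists x, (Both (Lab w (FPred (Tuple sz)))); split; first by constructor.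
      rewrite /=; congr (Both (Lab _ (FPred _))); apply: val_inj => /=.
      by rewrite -map_comp exs; apply/eq_in_map => v vs /=; rewrite hx.
    rewrite /= map_id /inst /= -map_comp; congr (NLab _ (NPred _ _)).
    by apply/eq_in_map => v vs /=; rewrite hx.
  move=> x' y' [-> ->]; have [x hx] := fr [:: a; b].
  exists x, (Both (Lab w (FEq (odflt x a) (odflt x b)))).
  split; first by constructor.
  + by rewrite /= !hx ?inE ?eqxx ?orbT.
  + by rewrite /inst /= !hx ?inE ?eqxx ?orbT.
Qed.

(** Proves the hypothesis of [nderiv_drop]: among all rules, those with the given principal
    expression remain, and one of their premisses is already included. *)
Ltac idle :=
  let R := fresh in
  rewrite /lfts /rgts; move=> ? ? R;
  destruct R; intros;
  repeat match goal with
  | H : nreplaceable _ _ |- _ => destruct H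
  | H : is_true (natomic ?A) |- _ =>
      is_var A; destruct A; try discriminate H; clear H
  end;
  simpl in *;
  repeat match goal with
  | H : _ \/ _ |- _ => destruct H
  | H : False |- _ => destruct H
  | H : (_, _) = (_, _) |- _ => first [discriminate H | injection H; clear H; intros]
  end;
  subst;
  first
    [ by eexists; [reflexivity | incl_prin]
    | by eexists; [eexists; reflexivity | incl_prin]
    | by eexists; [left; reflexivity | incl_prin]
    | by eexists; [right; reflexivity | incl_prin]
    | by eexists; [right; eexists; reflexivity | incl_prin] ].

Ltac incl_perm pS :=
  let e := fresh in
  move=> e; have := @Permutation_in _ _ _ e pS;
  rewrite /lfts /rgts /= ?In_cat /=; tauto.

Ltac decode :=
  repeat (subst; simpl in *; match goal with
  | H : map _ ?l = [::] |- _ => destruct l; [clear H | discriminate H]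
  | H : map _ ?l = _ :: _ |- _ =>
      destruct l; [discriminate H | injection H; clear H; intros]
  | H : tr_lexpr _ _ ?e = ?R |- _ =>
      lazymatch R with
      | NLab _ _ => idtac | NDen _ _ _ => idtac | NDom _ _ => idtac | NRel _ _ _ => idtac
      end; destruct e as [[? ?|? ? ?]|? ?|? ?]; try discriminate H;
      injection H; clear H; intros
  | H : tr_rexpr _ _ ?e = ?R |- _ =>
      lazymatch R with
      | NLab _ _ => idtac | NDen _ _ _ => idtac
      end; destruct e; try discriminate H; injection H; clear H; intros
  | H : tr_term _ ?t = ?R |- _ =>
      lazymatch R with NVar _ => idtac | NIota _ => idtac end;
      destruct t; try discriminate H; injection H; clear H; intros
  | H : tr_form _ ?A = ?R |- _ =>
      lazymatch R with
      | NEq _ _ => idtac | NAnd _ _ => idtac | NOr _ _ => idtac | NImp _ _ => idtac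
      | NAll _ => idtac | NEx _ => idtac | NBox _ => idtac | NDia _ => idtac
      | NLam _ _ => idtac | NBot _ => idtac
      end; destruct A; try discriminate H; try injection H; clear H; intros
  end);
  subst; simpl in *.

Ltac bv_sub := let x := fresh in
  move=> x; rewrite /bv_sequent /= ?(proj1 (bv_subst _ _)) ?cats0 ?(mem_cat, inE);
  repeat match goal with
  | |- context [x \in ?s] => case: (x \in s)
  | |- context [x == ?y] => case: (x == y)
  end;
  by rewrite ?orbT.

Ltac split1 h S0 pS :=
  have [S0 pS] := In_split1 (h _ (or_introl erefl));
  apply: (realizable_perm (Permutation_sym pS)).

Ltac split2 h S0 pS :=
  have [//|[S0 pS]] := In_split2 (h _ (or_introl erefl)) (h _ (or_intror (or_introl erefl)));
  apply: (realizable_perm (Permutation_sym pS)).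

(** For named rules that repeat their principal expressions in the premiss. *)
Ltac keep IH hp pS := apply: IH; apply: nderiv_incl hp; incl_perm pS.

(** For named rules that consume their principal expression E: it survives in the nameless premiss,
    and invertibility removes it at no cost in height. *)
Ltac drop IH E hp pS :=
  apply: IH; apply: (@nderiv_drop _ E);
    [idle | apply: nderiv_incl hp; incl_perm pS].

Ltac finish R :=
  split; [try split; by rewrite /= ?tr_inst |
         try split; by rewrite /= ?tr_inst | apply: R | bv_sub].

(** The instantiating variable is free in the conclusion or listed in F, so no binder of the
    conclusion uses it. *)
Ltac get_free_for fy hb y x A :=
  have fy : free_for y x A by
    apply: (proj1 (free_for_bv y x) A); apply: contra (hb y _);
    [ rewrite /bv_sequent /= !(inE, mem_cat) => ->; rewrite ?orbT
    | rewrite /nfv_seq /lfts /rgts /= !(mem_cat, mem_rcons, inE) eqxx ?orbT ].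

(** Of the infinitely many premisses of an eigenvariable rule, a single one with a fresh value is
    followed. Only finitely many variables are therefore collected. *)
Lemma nderiv_realizable (infL : infinite L) n S : nderiv n S -> realizable n S.
Proof.
elim: n S => [|n IH] S; first by [].
case=> prin [prems [R]].
case: R => {prin prems}.
- move=> w p ap h _; split2 h S0 pS.
  apply: (@realizable_init n [:: NLab w p] [:: NLab w p]) => els ers Γ Δ ? ?.
  decode.
  match goal with e : tr_form _ ?B = tr_form _ ?C |- _ =>
    have -> : B = C by apply: tr_atomic_inj e; rewrite e end.
  by apply: InitAtom; rewrite natomic_tr in ap.
- move=> w x y h _; split2 h S0 pS.
  apply: (@realizable_init n [:: NDen (NVar y) x w] [:: NDen (NVar y) x w]) => els ers Γ Δ ? ?.
  by decode; apply: InitDen.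
- move=> w h _; split1 h S0 pS.
  apply: (@realizable_init n [:: NLab w (NBot V)] [::]) => els ers Γ Δ ? ?.
  by decode; apply: InitBot.
- move=> w A B h hp; split1 h S0 pS.
  apply: (@realizable_rule1 n [::] [:: NLab w (NAnd A B)] [::] S0 [:: NLab w A; NLab w B] [::]).
    by drop IH (lft (NLab w (NAnd A B))) (hp _ erefl) pS.
  move=> els ers Γ Δ ? ? [hb hz hu]; decode.
  match goal with |- context [Lab ?w (FAnd ?A ?B)] =>
    exists [:: Both (Lab w A); Both (Lab w B)], [::] end.
  finish LAnd.
- move=> w A B h hp; split1 h S0 pS.
  apply: (@realizable_rule2 n [::] [::] [:: NLab w (NAnd A B)] S0
    [::] [:: NLab w A] [::] [:: NLab w B]).
  + by drop IH (rgt (NLab w (NAnd A B))) (hp _ (or_introl erefl)) pS.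
  + by drop IH (rgt (NLab w (NAnd A B))) (hp _ (or_intror erefl)) pS.
  move=> els ers Γ Δ ? ? [hb hz hu]; decode.
  match goal with |- context [Lab ?w (FAnd ?A ?B)] =>
    exists [::], [:: Lab w A], [::], [:: Lab w B] end.
  finish RAnd.
- move=> w A B h hp; split1 h S0 pS.
  apply: (@realizable_rule2 n [::] [:: NLab w (NOr A B)] [::] S0
    [:: NLab w A] [::] [:: NLab w B] [::]).
  + by drop IH (lft (NLab w (NOr A B))) (hp _ (or_introl erefl)) pS.
  + by drop IH (lft (NLab w (NOr A B))) (hp _ (or_intror erefl)) pS.
  move=> els ers Γ Δ ? ? [hb hz hu]; decode.
  match goal with |- context [Lab ?w (FOr ?A ?B)] =>
    exists [:: Both (Lab w A)], [::], [:: Both (Lab w B)], [::] end.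
  finish LOr.
- move=> w A B h hp; split1 h S0 pS.
  apply: (@realizable_rule1 n [::] [::] [:: NLab w (NOr A B)] S0 [::] [:: NLab w A; NLab w B]).
    by drop IH (rgt (NLab w (NOr A B))) (hp _ erefl) pS.
  move=> els ers Γ Δ ? ? [hb hz hu]; decode.
  match goal with |- context [Lab ?w (FOr ?A ?B)] =>
    exists [::], [:: Lab w A; Lab w B] end.
  finish ROr.
- move=> w A B h hp; split1 h S0 pS.
  apply: (@realizable_rule2 n [::] [:: NLab w (NImp A B)] [::] S0
    [::] [:: NLab w A] [:: NLab w B] [::]).
  + by drop IH (lft (NLab w (NImp A B))) (hp _ (or_introl erefl)) pS.
  + by drop IH (lft (NLab w (NImp A B))) (hp _ (or_intror erefl)) pS.
  move=> els ers Γ Δ ? ? [hb hz hu]; decode.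
  match goal with |- context [Lab ?w (FImp ?A ?B)] =>
    exists [::], [:: Lab w A], [:: Both (Lab w B)], [::] end.
  finish LImp.
- move=> w A B h hp; split1 h S0 pS.
  apply: (@realizable_rule1 n [::] [::] [:: NLab w (NImp A B)] S0 [:: NLab w A] [:: NLab w B]).
    by drop IH (rgt (NLab w (NImp A B))) (hp _ erefl) pS.
  move=> els ers Γ Δ ? ? [hb hz hu]; decode.
  match goal with |- context [Lab ?w (FImp ?A ?B)] =>
    exists [:: Both (Lab w A)], [:: Lab w B] end.
  finish RImp.
- move=> w y A h hp; split2 h S0 pS.
  apply: (@realizable_rule1 n [::] [:: NDom y w; NLab w (NAll A)] [::] S0
    [:: NLab w (inst y A); NDom y w; NLab w (NAll A)] [::]).
    by keep IH (hp _ erefl) pS.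
  move=> els ers Γ Δ ? ? [hb hz hu]; decode.
  match goal with |- context [[:: Dom ?y ?w, Both (Lab ?w (FAll ?x ?A)) & _]] =>
    get_free_for fy hb y x A;
    exists [:: Both (Lab w (subst_form y x A)); Dom y w; Both (Lab w (FAll x A))], [::] end.
  by finish LAll.
- move=> w A h hp; split1 h S0 pS.
  (* Not free in the conclusion and, being listed in F, not bound in it either: z is a legitimate
     eigenvariable for every naming considered. *)
  have [z zS] := infV (nfv_seq (rgt (NLab w (NAll A)) :: S0)).
  apply: (@realizable_rule1 n [:: z] [::] [:: NLab w (NAll A)] S0
    [:: NDom z w] [:: NLab w (inst z A)]).
    by drop IH (rgt (NLab w (NAll A))) (hp _ (ex_intro _ z erefl)) pS.
  move=> els ers Γ Δ ? ? [_ /(_ z (mem_head _ _) zS) fz _]; clear zS; decode.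
  match goal with |- context [Lab ?w (FAll ?x ?A)] =>
    have [_] := fresh_varr fz (or_introl erefl);
    rewrite /= inE negb_or => /andP[_ zA];
    have fA := proj1 (free_for_bv z x) A zA;
    exists [:: Dom z w], [:: Lab w (subst_form z x A)] end.
  by finish RAll.
- move=> w A h hp; split1 h S0 pS.
  have [z zS] := infV (nfv_seq (lft (NLab w (NEx A)) :: S0)).
  apply: (@realizable_rule1 n [:: z] [:: NLab w (NEx A)] [::] S0
    [:: NDom z w; NLab w (inst z A)] [::]).
    by drop IH (lft (NLab w (NEx A))) (hp _ (ex_intro _ z erefl)) pS.
  move=> els ers Γ Δ ? ? [_ /(_ z (mem_head _ _) zS) fz _]; clear zS; decode.
  match goal with |- context [Lab ?w (FEx ?x ?A)] =>
    have [_] := fresh_varl fz (or_introl erefl);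
    rewrite /= inE negb_or => /andP[_ zA];
    have fA := proj1 (free_for_bv z x) A zA;
    exists [:: Dom z w; Both (Lab w (subst_form z x A))], [::] end.
  by finish LEx.
- move=> w y A h hp; split2 h S0 pS.
  apply: (@realizable_rule1 n [::] [:: NDom y w] [:: NLab w (NEx A)] S0
    [:: NDom y w] [:: NLab w (NEx A); NLab w (inst y A)]).
    by keep IH (hp _ erefl) pS.
  move=> els ers Γ Δ ? ? [hb hz hu]; decode.
  match goal with |- context [([:: Dom ?y ?w & _], [:: Lab ?w (FEx ?x ?A) & _])] =>
    get_free_for fy hb y x A;
    exists [:: Dom y w], [:: Lab w (FEx x A); Lab w (subst_form y x A)] end.
  by finish REx.
- move=> w v A h hp; split2 h S0 pS.
  apply: (@realizable_rule1 n [::] [:: NRel V w v; NLab w (NBox A)] [::] S0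
    [:: NLab v A; NRel V w v; NLab w (NBox A)] [::]).
    by keep IH (hp _ erefl) pS.
  move=> els ers Γ Δ ? ? [hb hz hu]; decode.
  match goal with |- context [[:: Rel ?w ?v, Both (Lab ?w (FBox ?A)) & _]] =>
    exists [:: Both (Lab v A); Rel w v; Both (Lab w (FBox A))], [::] end.
  finish LBox.
- move=> w A h hp; split1 h S0 pS.
  have [u uS] := infL (nlabels_seq (rgt (NLab w (NBox A)) :: S0)).
  apply: (@realizable_rule1 n [::] [::] [:: NLab w (NBox A)] S0 [:: NRel V w u] [:: NLab u A]).
    by drop IH (rgt (NLab w (NBox A))) (hp _ (ex_intro _ u erefl)) pS.
  move=> els ers Γ Δ ? ? [_ _ /(_ u uS) fu]; clear uS; decode.
  match goal with |- context [Lab ?w (FBox ?A)] =>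
    exists [:: Rel w u], [:: Lab u A] end.
  by finish RBox.
- move=> w A h hp; split1 h S0 pS.
  have [u uS] := infL (nlabels_seq (lft (NLab w (NDia A)) :: S0)).
  apply: (@realizable_rule1 n [::] [:: NLab w (NDia A)] [::] S0 [:: NRel V w u; NLab u A] [::]).
    by drop IH (lft (NLab w (NDia A))) (hp _ (ex_intro _ u erefl)) pS.
  move=> els ers Γ Δ ? ? [_ _ /(_ u uS) fu]; clear uS; decode.
  match goal with |- context [Lab ?w (FDia ?A)] =>
    exists [:: Rel w u; Both (Lab u A)], [::] end.
  by finish LDia.
- move=> w v A h hp; split2 h S0 pS.
  apply: (@realizable_rule1 n [::] [:: NRel V w v] [:: NLab w (NDia A)] S0
    [:: NRel V w v] [:: NLab w (NDia A); NLab v A]).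
    by keep IH (hp _ erefl) pS.
  move=> els ers Γ Δ ? ? [hb hz hu]; decode.
  match goal with |- context [([:: Rel ?w ?v & _], [:: Lab ?w (FDia ?A) & _])] =>
    exists [:: Rel w v], [:: Lab w (FDia A); Lab v A] end.
  finish RDia.
- move=> w x h hp.
  apply: (@realizable_rule1 n [::] [::] [::] S [:: NLab w (NEq x x)] [::]).
    by apply: IH (hp _ erefl).
  move=> els ers Γ Δ ? ? _; decode.
  by exists [:: Both (Lab w (FEq x x))], [::]; finish RefEq.
- move=> w v y z h hp; split1 h S0 pS.
  apply: (@realizable_rule1 n [::] [:: NLab w (NEq y z)] [::] S0
    [:: NLab v (NEq y z); NLab w (NEq y z)] [::]).
    by keep IH (hp _ erefl) pS.
  move=> els ers Γ Δ ? ? _; decode.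
  match goal with |- context [Lab ?w (FEq ?y ?z)] =>
    exists [:: Both (Lab v (FEq y z)); Both (Lab w (FEq y z))], [::] end.
  finish RigVar.
- (* If E[y/x] is the very identity w : y = z, a single copy of it may be
     present; then E[z/x] is z = z or y = z. *)
  move=> w y z E hE h hp.
  case: (In_split2 (h _ (or_introl erefl)) (h _ (or_intror (or_introl erefl)))).
    case=> eE; have [ez|ez] : inst_expr z E = NLab w (NEq z z) \/
        inst_expr z E = NLab w (NEq y z).
      case: hE eE => //= -[] //= a b _ [].
      by case: a b => [a|] [b|] /= *; subst; auto.
      apply: (@realizable_rule1 n [::] [::] [::] S [:: NLab w (NEq z z)] [::]).
        by apply: IH; have := hp _ erefl; rewrite ez.
      move=> els ers Γ Δ ? ? _; decode.
      by exists [:: Both (Lab w (FEq z z))], [::]; finish RefEq.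
    apply: realizableS; apply: IH; apply: nderiv_incl (hp _ erefl) => e.
    by rewrite ez In_cat /= => -[[<-|//]|//]; apply: h; right; left.
  case=> S0 pS; apply: (realizable_perm (Permutation_sym pS)).
  apply: (@realizable_rule1 n [::] [:: inst_expr y E; NLab w (NEq y z)] [::] S0
    [:: inst_expr z E; inst_expr y E; NLab w (NEq y z)] [::]).
    by keep IH (hp _ erefl) pS.
  move=> [//|e els] ers Γ Δ [ey] ? ? _.
  have [x [E' [hE' eE ez]]] := nreplaceable_name z hE ey; subst e; decode.
  match goal with |- context [Lab ?w (FEq y z)] =>
    exists [:: subst_lexpr z x E'; subst_lexpr y x E'; Both (Lab w (FEq y z))], [::] end.
  have bE v : bv_lexpr (subst_lexpr v x E') = [::] by case: hE' => // -[].
  split=> //; first by rewrite /= ey ez.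
    exact: Repl.
  by move=> v; rewrite /bv_sequent /= !bE.
- move=> w A t h hp; split1 h S0 pS.
  have [z zS] := infV (nfv_seq (lft (NLab w (NLam A t)) :: S0)).
  apply: (@realizable_rule1 n [:: z] [:: NLab w (NLam A t)] [::] S0
    [:: NDen t z w; NLab w (inst z A)] [::]).
    by drop IH (lft (NLab w (NLam A t))) (hp _ (ex_intro _ z erefl)) pS.
  move=> els ers Γ Δ ? ? [_ /(_ z (mem_head _ _) zS) fz _]; clear zS; decode.
  match goal with |- context [Lab ?w (FLam ?x ?A ?t)] =>
    have [_] := fresh_varl fz (or_introl erefl);
    rewrite /= inE mem_cat !negb_or => /and3P[_ zA _];
    have fA := proj1 (free_for_bv z x) A zA;
    exists [:: Both (Den t z w); Both (Lab w (subst_form z x A))], [::] end.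
  by finish LLam.
- move=> w y A t h hp; split1 h S0 pS.
  (* The instantiating y need not occur in the conclusion, so it joins the variables that binders
     avoid. *)
  apply: (@realizable_rule2 n [:: y] [::] [:: NLab w (NLam A t)] S0
    [::] [:: NLab w (NLam A t); NDen t y w] [::] [:: NLab w (NLam A t); NLab w (inst y A)]).
  + by keep IH (hp _ (or_introl erefl)) pS.
  + by keep IH (hp _ (or_intror erefl)) pS.
  move=> els ers Γ Δ ? ? [hb _ _]; decode.
  match goal with |- context [Lab ?w (FLam ?x ?A ?t)] =>
    get_free_for fy hb y x A;
    exists [::], [:: Lab w (FLam x A t); Den t y w],
      [::], [:: Lab w (FLam x A t); Lab w (subst_form y x A)] end.
  by finish RLam.
- move=> w x A h hp; split1 h S0 pS.
  apply: (@realizable_rule1 n [::] [:: NDen (NIota A) x w] [::] S0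
    [:: NLab w (inst x A); NDen (NIota A) x w] [::]).
    by keep IH (hp _ erefl) pS.
  move=> els ers Γ Δ ? ? [hb _ _]; decode.
  match goal with |- context [Den (TIota ?x ?A) ?y ?w] =>
    get_free_for fy hb y x A;
    exists [:: Both (Lab w (subst_form y x A)); Both (Den (TIota x A) y w)], [::] end.
  by finish LD1.
- move=> w x y A h hp; split1 h S0 pS.
  apply: (@realizable_rule2 n [:: y] [:: NDen (NIota A) x w] [::] S0
    [:: NDen (NIota A) x w] [:: NLab w (inst y A)]
    [:: NLab w (NEq x y); NDen (NIota A) x w] [::]).
  + by keep IH (hp _ (or_introl erefl)) pS.
  + by keep IH (hp _ (or_intror erefl)) pS.
  move=> els ers Γ Δ ? ? [hb _ _]; decode.
  match goal with |- context [Den (TIota ?x1 ?A) ?x2 ?w] =>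
    get_free_for fy hb y x1 A;
    exists [:: Both (Den (TIota x1 A) x2 w)], [:: Lab w (subst_form y x1 A)],
      [:: Both (Lab w (FEq x2 y)); Both (Den (TIota x1 A) x2 w)], [::] end.
  by finish LD2.
- move=> w x A h hp; split1 h S0 pS.
  have [z zS] := infV (nfv_seq (rgt (NDen (NIota A) x w) :: S0)).
  apply: (@realizable_rule2 n [:: z] [::] [:: NDen (NIota A) x w] S0
    [::] [:: NLab w (inst x A)] [:: NLab w (inst z A)] [:: NLab w (NEq x z)]).
  + by drop IH (rgt (NDen (NIota A) x w)) (hp _ (or_introl erefl)) pS.
  + by drop IH (rgt (NDen (NIota A) x w)) (hp _ (or_intror (ex_intro _ z erefl))) pS.
  move=> els ers Γ Δ ? ? [hb /(_ z (mem_head _ _) zS) fz _]; clear zS; decode.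
  match goal with |- context [Den (TIota ?x1 ?A) ?x2 ?w] =>
    get_free_for fx hb x2 x1 A;
    have [_] := fresh_varr fz (or_introl erefl);
    rewrite /= inE negb_or => /andP[_ zA];
    have fA := proj1 (free_for_bv z x1) A zA;
    exists [::], [:: Lab w (subst_form x2 x1 A)],
      [:: Both (Lab w (subst_form z x1 A))], [:: Lab w (FEq x2 z)] end.
  by finish RD.
- move=> w x h hp.
  apply: (@realizable_rule1 n [::] [::] [::] S [:: NDen (NVar x) x w] [::]).
    by apply: IH (hp _ erefl).
  move=> els ers Γ Δ ? ? _; decode.
  by exists [:: Both (Den (TVar x) x w)], [::]; finish DenVar.
- move=> w x y h hp; split1 h S0 pS.
  apply: (@realizable_rule1 n [::] [:: NDen (NVar y) x w] [::] S0
    [:: NLab w (NEq y x); NDen (NVar y) x w] [::]).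
    by keep IH (hp _ erefl) pS.
  move=> els ers Γ Δ ? ? _; decode.
  match goal with |- context [Den (TVar ?y) ?x ?w] =>
    exists [:: Both (Lab w (FEq y x)); Both (Den (TVar y) x w)], [::] end.
  finish DenId.
- move=> w nN h hp.
  apply: (@realizable_rule1 n [::] [::] [::] S [:: NRel V w w] [::]).
    by apply: IH (hp _ erefl).
  move=> els ers Γ Δ ? ? _; decode.
  by exists [:: Rel w w], [::]; finish RuleRefW.
- move=> w nN h hp.
  have [u uS] := infL (nlabels_seq S).
  apply: (@realizable_rule1 n [::] [::] [::] S [:: NRel V w u] [::]).
    by apply: IH (hp _ (ex_intro _ u erefl)).
  move=> els ers Γ Δ ? ? [_ _ /(_ u uS) fu]; clear uS; decode.
  by exists [:: Rel w u], [::]; finish RuleSer.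
- move=> nN h hp.
  have [u uS] := infL (nlabels_seq S).
  apply: (@realizable_rule1 n [::] [::] [::] S [:: NRel V u u] [::]).
    by apply: IH (hp _ (ex_intro _ u erefl)).
  move=> els ers Γ Δ ? ? [_ _ /(_ u uS) fu]; clear uS; decode.
  by exists [:: Rel u u], [::]; finish RuleSer.
- move=> w v u nN h hp.
  case: (In_split2 (h _ (or_introl erefl)) (h _ (or_intror (or_introl erefl)))).
    (* Here w, v and u coincide: the new relational atom is already present and the step is
       omitted. *)
    case=> wv vu; apply: realizableS; apply: IH.
    apply: nderiv_incl (hp _ erefl) => e; rewrite In_cat /= => -[[<-|//]|//].
    by apply: h; left; rewrite -vu.
  case=> S0 pS; apply: (realizable_perm (Permutation_sym pS)).
  apply: (@realizable_rule1 n [::] [:: NRel V w v; NRel V v u] [::] S0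
    [:: NRel V w u; NRel V w v; NRel V v u] [::]).
    by keep IH (hp _ erefl) pS.
  move=> els ers Γ Δ ? ? _; decode.
  match goal with |- context [[:: Rel ?w ?v, Rel ?v ?u & _]] =>
    exists [:: Rel w u; Rel w v; Rel v u], [::] end.
  by finish RuleTrans.
- move=> w v u nN h hp.
  case: (In_split2 (h _ (or_introl erefl)) (h _ (or_intror (or_introl erefl)))).
    (* Both principal atoms may be a single occurrence of w R v; this contracted instance is the
       rule [RuleEuclc]. *)
    case=> vu; subst u; split1 h S0 pS.
    apply: (@realizable_rule1 n [::] [:: NRel V w v] [::] S0
      [:: NRel V v v; NRel V w v] [::]).
      by keep IH (hp _ erefl) pS.
    move=> els ers Γ Δ ? ? _; decode.
    match goal with |- context [Rel ?w ?v] => exists [:: Rel v v; Rel w v], [::] end.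
    by finish RuleEuclc.
  case=> S0 pS; apply: (realizable_perm (Permutation_sym pS)).
  apply: (@realizable_rule1 n [::] [:: NRel V w v; NRel V w u] [::] S0
    [:: NRel V v u; NRel V w v; NRel V w u] [::]).
    by keep IH (hp _ erefl) pS.
  move=> els ers Γ Δ ? ? _; decode.
  match goal with |- context [[:: Rel ?w ?v, Rel ?w ?u & _]] =>
    exists [:: Rel v u; Rel w v; Rel w u], [::] end.
  by finish RuleEucl.
- move=> w v nN h hp; split1 h S0 pS.
  apply: (@realizable_rule1 n [::] [:: NRel V w v] [::] S0
    [:: NRel V v v; NRel V w v] [::]).
    by keep IH (hp _ erefl) pS.
  move=> els ers Γ Δ ? ? _; decode.
  match goal with |- context [Rel ?w ?v] => exists [:: Rel v v; Rel w v], [::] end.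
  by finish RuleEuclc.
- move=> w v x nN h hp; split2 h S0 pS.
  apply: (@realizable_rule1 n [::] [:: NDom x w; NRel V w v] [::] S0
    [:: NDom x v; NDom x w; NRel V w v] [::]).
    by keep IH (hp _ erefl) pS.
  move=> els ers Γ Δ ? ? _; decode.
  match goal with |- context [[:: Dom ?x ?w, Rel ?w ?v & _]] =>
    exists [:: Dom x v; Dom x w; Rel w v], [::] end.
  by finish RuleIncr.
- move=> w v x nN h hp; split2 h S0 pS.
  apply: (@realizable_rule1 n [::] [:: NDom x v; NRel V w v] [::] S0
    [:: NDom x w; NDom x v; NRel V w v] [::]).
    by keep IH (hp _ erefl) pS.
  move=> els ers Γ Δ ? ? _; decode.
  match goal with |- context [[:: Dom ?x ?v, Rel ?w ?v & _]] =>
    exists [:: Dom x w; Dom x v; Rel w v], [::] end.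
  by finish RuleDecr.
- move=> w x nN h hp.
  apply: (@realizable_rule1 n [::] [::] [::] S [:: NDom x w] [::]).
    by apply: IH (hp _ erefl).
  move=> els ers Γ Δ ? ? _; decode.
  by exists [:: Dom x w], [::]; finish RuleCons.
Qed.

(** * Alphabetic variants and the equivalence of the two calculi *)

Lemma variant_rexpr_tr e e' : variant_rexpr e e' -> tr_rexpr id id e = tr_rexpr id id e'.
Proof.
case=> [w A A'|t t' x w] /= h.
- by congr NLab; apply: (proj1 alpha_tr _ _ _ h V id id) => x y /eqP.
- by congr NDen; apply: (proj2 alpha_tr _ _ _ h V id id) => y z /eqP.
Qed.

Lemma variant_tr T T' : variant T T' ->
  Permutation (tr_seq id id T) (tr_seq id id T').
Proof.
case=> T0 p [h1 h2]; apply: Permutation_trans (tr_seq_perm _ _ p).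
suff -> : tr_seq id id T = tr_seq id id T0 by [].
congr cat.
- elim: h1 => //= e e' l l' ee' _ ->; congr ((_, _) :: _).
  by case: ee' => //= ? ?; apply: variant_rexpr_tr.
- by elim: h2 => //= e e' l l' /variant_rexpr_tr -> _ ->.
Qed.

Lemma rexpr_variant_avoiding (F : seq V) (e : rexpr) : exists2 e', variant_rexpr e e' &
  {in bv_rexpr e', forall x, x \notin F}.
Proof.
case: e => [w A|t x w].
- have [A' e hA] := proj1 (rename_bound F) A id.
  exists (Lab w A') => //; constructor.
  by apply: (proj1 tr_alpha _ _ _ _ id id) (esym e) => y z /= ->.
- have [t' e ht] := proj2 (rename_bound F) t id.
  exists (Den t' x w) => //; constructor.
  by apply: (proj2 tr_alpha _ _ _ _ id id) (esym e) => y z /= ->.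
Qed.

Lemma Forall2_avoiding T (R : T -> T -> Prop) (bv : T -> seq V) (F : seq V) s :
  (forall e, exists2 e', R e e' & {in bv e', forall x, x \notin F}) ->
  exists2 s', Forall2 R s s' & {in flatten (map bv s'), forall x, x \notin F}.
Proof.
move=> h; elim: s => [|e s [s' Rs hs]]; first by exists [::].
have [e' Re he] := h e; exists (e' :: s'); first by constructor.
by move=> x; rewrite /= mem_cat => /orP[/he|/hs].
Qed.

Lemma variant_avoiding (F : seq V) (T : sequent) : exists2 T', variant T T' &
  {in bv_sequent T', forall x, x \notin F}.
Proof.
have [Γ h1 f1] : exists2 Γ, Forall2 (@variant_lexpr sg V L) T.1 Γ &
    {in flatten (map (@bv_lexpr sg V L) Γ), forall x, x \notin F}.
  apply: Forall2_avoiding => -[e|x w|w v].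
  + have [e' ee' he] := rexpr_variant_avoiding F e.
    by exists (Both e') => //; constructor.
  + by exists (Dom x w) => //; constructor.
  + by exists (Rel w v) => //; constructor.
have [Δ h2 f2] := Forall2_avoiding T.2 (rexpr_variant_avoiding F).
exists (Γ, Δ); first by exists (Γ, Δ).
by move=> x; rewrite /bv_sequent mem_cat => /orP[/f1|/f2].
Qed.

(** Variants have the same translation up to order, which gives one direction. For the other,
    [nderiv_realizable] yields a finite list of variables, and a variant of T whose binders avoid it
    receives the named derivation. *)
Lemma derivable_nderiv (infL : infinite L) n T :
  derivable N n T <-> nderiv n (tr_seq id id T).
Proof.
split.
- case=> T' [h [v hn /derives_nderiv d]]; apply: (nderiv_leq hn).
  apply: nderiv_incl (d id id) => e.
  exact: Permutation_in (Permutation_sym (variant_tr v)).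
- case/(nderiv_realizable infL) => F hF.
  have [T' v hT'] := variant_avoiding F T.
  have [h hn d] := hF T' (Permutation_sym (variant_tr v)) hT'.
  by exists T', h.
Qed.

End Nameless.

Theorem mainTheorem5 (sg : signature) (V L : eqType)
    (infV : infinite V) (infL : infinite L)
    (N : nonlogical_rule -> Prop) (n : nat) :
  (forall (Γ' Γ : seq (lexpr sg V L)) (Δ : seq (rexpr sg V L)),
     derivable N n (Γ' ++ Γ' ++ Γ, Δ) -> derivable N n (Γ' ++ Γ, Δ)) /\
  (forall (Γ : seq (lexpr sg V L)) (Δ Δ' : seq (rexpr sg V L)),
     derivable N n (Γ, Δ ++ Δ' ++ Δ') -> derivable N n (Γ, Δ ++ Δ')).
Proof.
(* After translation, every expression of the premiss occurs in the conclusion, and [nderiv_incl]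
   keeps the bound n. *)
split=> [Γ' Γ Δ|Γ Δ Δ'] /(derivable_nderiv infV _ infL) d;
  apply/(derivable_nderiv infV _ infL); apply: nderiv_incl d => e;
  rewrite /tr_seq /= !map_cat !In_cat; tauto.
Qed.
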